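(* Let $n \geq 1$ and let $\boldsymbol{b} = (b_1,\dots,b_n) \in (\mathbb{R}_{>0})^n$. If $N(\boldsymbol{b}) \geq 3$, where $N(\boldsymbol{b}) := \#\{b_1,\dots,b_n\}$ is the number of distinct values among $b_1,\dots,b_n$, then the Lagrangian torus $T(\boldsymbol{b}) = S^1(b_1)\times\cdots\times S^1(b_n) \subset \mathbb{C}^n$ is not Hamiltonian volume minimizing in $(\mathbb{C}^n,\omega_0)$.
   Context: $\mathbb{C}^n\cong\mathbb{R}^{2n}$ carries the standard symplectic form $\omega_0 = dx_1\wedge dy_1+\cdots+dx_n\wedge dy_n$, its standard complex structure, and the standard Euclidean metric. For $b>0$, $S^1(b)\subset \mathbb{R}^2\cong\mathbb{C}$ denotes the boundary of the round disc of area $b$ centred at the origin, i.e. the circle of radius $\sqrt{b/\pi}$. The product torus $T(\boldsymbol{b})=S^1(b_1)\times\cdots\times S^1(b_n)$ is a Lagrangian submanifold of $(\mathbb{C}^n,\omega_0)$. Let $(M,\omega,J)$ be a Kähler manifold. A diffeomorphism $\phi$ of $M$ belongs to $\mathrm{Ham}_c(M,\omega)$ if it is the time-one map of the flow $\{\phi^t_H\}_{0\le t\le 1}$, $\phi_H^0=\mathrm{id}_M$, of the time-dependent Hamiltonian vector field $X_{H_t}$ of some compactly supported smooth function $H\in C_c^\infty([0,1]\times M)$. For a closed embedded Lagrangian submanifold $L\subset M$, $\mathrm{Vol}(L)$ denotes its Riemannian volume for the metric induced from $M$. $L$ is called Hamiltonian volume minimizing if $\mathrm{Vol}(\phi(L))\ge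 \mathrm{Vol}(L)$ for every $\phi\in\mathrm{Ham}_c(M,\omega)$. *)

(* Defs.v *)
From HB Require Import structures.
From mathcomp Require Import all_boot all_order all_algebra.
From mathcomp Require Import all_classical all_reals all_analysis.

Set Implicit Arguments.
Unset Strict Implicit.
Unset Printing Implicit Defensive.

Import Order.TTheory GRing.Theory Num.Theory.
Import numFieldNormedType.Exports.

Local Open Scope classical_set_scope.
Local Open Scope ring_scope.

(* C^n = R^(2n) is the space 'rV[R]_(n + n) of rows
   (x_1, ..., x_n, y_1, ..., y_n). *)

Section Smooth.
Variables (R : realType) (V W : normedModType R).

(* All iterated directional derivatives of f exist and are (Frechet)
   differentiable, hence continuous, on U: for U open in a finite-dimensional
   space this says that f is C^oo on U. *)
Definition smooth_on (U : set V) (f : V -> W) : Prop :=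
  forall (s : seq V) (x : V), U x ->
    differentiable (foldr (fun v (g : V -> W) => 'D_v g) f s) x.

Definition smooth (f : V -> W) : Prop := smooth_on setT f.

End Smooth.

Definition diffeomorphism (R : realType) (V : normedModType R)
    (phi : V -> V) : Prop :=
  smooth phi /\
  exists psi : V -> V, [/\ smooth psi, cancel phi psi & cancel psi phi].

Section Symplectic.
Variables (R : realType) (n : nat).
Local Notation V := 'rV[R]_(n + n).

Definition xcoord (z : V) (j : 'I_n) : R := z 0 (lshift n j).
Definition ycoord (z : V) (j : 'I_n) : R := z 0 (rshift n j).

Definition omega0 (u v : V) : R :=
  \sum_(j < n) (xcoord u j * ycoord v j - ycoord u j * xcoord v j).

(* The opposite sign convention for X_h yields the same group Ham_c, since
   h may be replaced by - h. *)
Definition hamiltonian_vf (h : V -> R) (X : V -> V) : Prop :=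
  forall z v : V, omega0 (X z) v = 'D_v h z.

(* A smooth function on the manifold with boundary [0,1] x R^(2n) is one that
   extends smoothly to a neighbourhood; by a cut-off, such an extension may be
   taken on R x R^(2n). H is this extension, and only its restriction to
   [0,1] x R^(2n) matters. *)
Definition Cc_smooth (H : R * V -> R) : Prop :=
  smooth H /\
  exists2 K : set V, compact K &
    forall (t : R) (z : V), 0 <= t <= 1 -> ~ K z -> H (t, z) = 0.

(* The derivative in t is relative to [0,1], i.e. one-sided at 0 and 1. *)
Definition hamiltonian_flow (H : R * V -> R) (Phi : R -> V -> V) : Prop :=
  exists X : R -> V -> V,
    [/\ forall t : R, 0 <= t <= 1 -> hamiltonian_vf (fun z => H (t, z)) (X t),
        forall z : V, Phi 0 z = z
      & forall (t : R) (z : V), 0 <= t <= 1 ->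
          h^-1 *: (Phi (t + h) z - Phi t z)
            @[h --> within [set h | 0 <= t + h <= 1] (0 : R)^']
            --> X t (Phi t z)].

Definition Ham_c (phi : V -> V) : Prop :=
  diffeomorphism phi /\
  exists (H : R * V -> R) (Phi : R -> V -> V),
    [/\ Cc_smooth H, hamiltonian_flow H Phi
      & forall z : V, phi z = Phi 1 z].

End Symplectic.

Section Volume.
Variable R : realType.

(* n-dimensional Lebesgue integral of a nonnegative Borel function, as an
   iterated integral (Tonelli). *)
Fixpoint integral_rV (n : nat) : ('rV[R]_n -> \bar R) -> \bar R :=
  match n with
  | 0 => fun f => f 0
  | k.+1 => fun f =>
      (\int[@lebesgue_measure R]_t
         integral_rV (fun v : 'rV[R]_k => f (row_mx (t%:M : 'rV[R]_1) v)))%E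
  end.

Definition borel_rV (n : nat) : set (set 'rV[R]_n) := <<s @open 'rV[R]_n >>.

(* jacobian p x has the partial derivatives of p at x as its rows, so this is
   sqrt (det (g_ij)) for the metric induced by p from the Euclidean one. *)
Definition volume_density (n m : nat) (p : 'rV[R]_n -> 'rV[R]_m)
    (x : 'rV[R]_n) : R :=
  Num.sqrt (\det (jacobian p x *m (jacobian p x)^T)).

Definition immersion_on (n m : nat) (U : set 'rV[R]_n)
    (p : 'rV[R]_n -> 'rV[R]_m) : Prop :=
  smooth_on U p /\ forall x, U x -> row_free (jacobian p x).

(* v is the n-dimensional Riemannian volume of the compact submanifold L:
   L is partitioned into finitely many pieces p_i(A_i), where A_i is a Borel
   subset of the domain U_i of a local parametrisation p_i of L which is
   injective on A_i, and v is the sum of the integrals of the volume densities.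
   By the change of variables formula v does not depend on these choices. *)
Definition riemannian_volume (n m : nat) (L : set 'rV[R]_m) (v : \bar R) :
    Prop :=
  exists (N : nat) (U A : 'I_N -> set 'rV[R]_n)
         (p : 'I_N -> 'rV[R]_n -> 'rV[R]_m),
    [/\ forall i, [/\ open (U i), immersion_on (U i) (p i)
                    & p i @` U i `<=` L],
        forall i, [/\ borel_rV (A i), A i `<=` U i
                    & forall x y, A i x -> A i y -> p i x = p i y -> x = y],
        L = \bigcup_i (p i @` A i),
        trivIset setT (fun i => p i @` A i)
      & v = (\sum_(i < N)
               integral_rV (fun x => (\1_(A i) x * volume_density (p i) x)%:E))%E].

End Volume.

(* Meant for closed embedded Lagrangian submanifolds L of R^(2n), for which v
   and w below exist and are unique. *)
Definition hamiltonian_volume_minimizing (R : realType) (n : nat)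
    (L : set 'rV[R]_(n + n)) : Prop :=
  forall phi : 'rV[R]_(n + n) -> 'rV[R]_(n + n), Ham_c phi ->
  forall v w : \bar R,
    riemannian_volume n L v -> riemannian_volume n (phi @` L) w -> (v <= w)%E.

Definition circle (R : realType) (b : R) : set (R * R) :=
  [set q | Num.sqrt (q.1 ^+ 2 + q.2 ^+ 2) = Num.sqrt (b / pi)].

Definition product_torus (R : realType) (n : nat) (b : 'I_n -> R) :
    set 'rV[R]_(n + n) :=
  [set z | forall j : 'I_n, circle (b j) (xcoord z j, ycoord z j)].

Definition num_distinct (R : realType) (n : nat) (b : 'I_n -> R) : nat :=
  size (undup (codom b)).

(* Main.v *)
(* Let a < b < c be three of the areas. The segment in direction (1, -1, -1) through
   (a, b, c) meets the facets x_1 = 0 and x_2 = 0 of the moment polytope of C^3 at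
   interior points (as b < c): it is a symmetric probe, and the torus over (a, b, c)
   is Hamiltonian isotopic to the torus over the reflected point (b, a, c - (b - a)),
   whose volume is smaller. The isotopy is explicit: with
   H0 = Re (z_1 conj z_2 conj z_3) / |z_3|, which reduces to a height function on the
   sphere over the probe, it is the flow of g(Q) H0, where Q is a sum of squares of
   integrals of H0 that vanishes on both tori and g is a cut-off. *)

From HB Require Import structures.
Require Import Defs.
From mathcomp Require Import all_boot all_order all_algebra.
From mathcomp Require Import all_classical all_reals all_analysis.
From mathcomp Require Import measurable_realfun ring lra.

Set Implicit Arguments.
Unset Strict Implicit.
Unset Printing Implicit Defensive.

Import Order.TTheory GRing.Theory Num.Theory.
Import numFieldNormedType.Exports.

Local Open Scope classical_set_scope.
Local Open Scope ring_scope.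

(** * Smooth functions *)

(** H0 has no compact support and is singular where z_3 = 0, and cutting off a Hamiltonian usually
    destroys any closed formula for its flow. The factor g(Q) keeps one: Q Poisson commutes with H0,
    so both are constants of the motion, and the flow is assembled from [cos], [sin] and [Num.sqrt].
    Its group law, inverse, velocity and smoothness are all checked on the formula itself. Two
    demands shape Q. It contains an integral for every index other than that of z_1, so that its
    sublevel sets are bounded in all coordinates. And Q must be small only where |z_2| < |z_3|, away
    from the singularity; this is where b < c enters. Dividing by |z_3| turns the flow of H0 into a
    rotation with constant speed, whose quarter turn exchanges |z_1| and |z_2|. The volume of a
    product torus is the product of the lengths of its circles, so in the comparison the factors of
    a and b cancel and c - (b - a) < c decides. *)

Section SmoothCalculus.
Variable R : realType.
Implicit Types V W : normedModType R.

Lemma near_eq_differentiable V W (f g : V -> W) (x : V) :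
  (\near x, f x = g x) -> differentiable f x -> differentiable g x.
Proof.
move=> fg /diff_locallyP[fc fe].
have ge : g \o shift x = cst (g x) + 'd f x +o_ 0 id.
  apply/eqaddoP => e e0; move/eqaddoP : fe => /(_ e e0).
  have fgs : \forall h \near (0 : V), f (h + x) = g (h + x).
    by move: (fg); rewrite (near_shift 0) subr0.
  apply: filter_app; near=> h.
  have fgh : f (h + x) = g (h + x) by near: h.
  by rewrite !fctE /= fgh (nbhs_singleton fg).
by apply/diff_locallyP; rewrite (diff_unique fc ge).
Unshelve. all: by end_near. Qed.

Lemma derive_comp V (h : R -> R) (f : V -> R) (v x : V) :
  differentiable f x -> differentiable h (f x) ->
  'D_v (h \o f) x = 'D_1 h (f x) * 'D_v f x.
Proof.
move=> df dh; rewrite deriveE; last exact: differentiable_comp.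
rewrite diff_comp//= !deriveE//.
by rewrite -{1}['d f x v]mulr1 -[_ * 1]/(_ *: (1 : R^o)) linearZ /= mulrC.
Qed.

(** Smoothness graded by order, so that closure properties can be proved by induction on [k]. The
    iterated derivatives of order at most [k] are required to be differentiable, so [Ck 0] already
    means differentiability. *)
Definition Ck (V W : normedModType R) k (U : set V) (f : V -> W) :=
  forall s : seq V, (size s <= k)%N -> forall x, U x ->
    differentiable (foldr (fun v (g : V -> W) => 'D_v g) f s) x.

Lemma smooth_onE V W (U : set V) (f : V -> W) :
  smooth_on U f <-> forall k, Ck k U f.
Proof.
split=> [h k s _ x|h s x]; first exact: h.
exact: (h (size s)).
Qed.

(** In [foldr] the last direction of the list is differentiated first, hence the use of [rcons] to
    split off the innermost derivative. *)
Lemma CkS V W k (U : set V) (f : V -> W) : Ck k.+1 U f <->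
  (forall x, U x -> differentiable f x) /\ forall v, Ck k U ('D_v f).
Proof.
split=> [h|[h0 h] s]; first split=> [x Ux|v s sk x Ux].
- exact: (h [::]).
- by have := h (rcons s v); rewrite size_rcons foldr_rcons; exact.
- case/lastP: s => [_ x Ux|s v]; first exact: h0.
  by rewrite size_rcons foldr_rcons; exact: h.
Qed.

Lemma Ck_diff V W k (U : set V) (f : V -> W) x :
  Ck k U f -> U x -> differentiable f x.
Proof. by move=> h; exact: (h [::]). Qed.

Lemma CkW V W k (U : set V) (f : V -> W) : Ck k.+1 U f -> Ck k U f.
Proof. by move=> h s sk; apply: h; exact: leqW. Qed.

(** As U is open, equality on U is equality near each of its points, which passes to derivatives of
    every order. *)
Lemma Ck_ext V W k (U : set V) (f g : V -> W) : open U ->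
  (forall x, U x -> f x = g x) -> Ck k U f -> Ck k U g.
Proof.
move=> oU; have near_ext (a b : V -> W) x : (forall x, U x -> a x = b x) ->
    U x -> \near x, a x = b x.
  by move=> ab Ux; apply: filterS ab _; exact: open_nbhs_nbhs.
elim: k f g => [|k IH] f g fg.
  move=> h [|//] _ x Ux /=; apply: near_eq_differentiable (h [::] _ x Ux) => //.
  exact: near_ext.
move=> /CkS[hd h]; apply/CkS; split=> [x Ux|v].
  by apply: near_eq_differentiable (hd x Ux) => //; exact: near_ext.
apply: IH (h v) => x Ux; apply: near_eq_derive; exact: near_ext.
Qed.

Lemma Ck_union V W k (U : set V) (A B : set V) (f : V -> W) :
  U `<=` A `|` B -> Ck k A f -> Ck k B f -> Ck k U f.
Proof. by move=> UAB hA hB s sk x /UAB[]; [exact: hA|exact: hB]. Qed.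

Lemma Ck_cst V W k (U : set V) (c : W) : Ck k U (fun=> c).
Proof.
elim: k c => [|k IH] c; first by move=> [|//] _ x _ /=; exact: differentiable_cst.
apply/CkS; split=> [x _|v]; first exact: differentiable_cst.
by rewrite (_ : 'D_v _ = fun=> 0) //; apply/funext => x; exact: derive_cst.
Qed.

Lemma Ck_linear V W k (U : set V) (f : {linear V -> W}) :
  continuous f -> Ck k U f.
Proof.
move=> fc; have df x : differentiable f x by exact/linear_differentiable.
case: k => [[|//] _ x _ /=|k]; first exact: df.
apply/CkS; split=> // v; rewrite (_ : 'D_v f = fun=> f v); first exact: Ck_cst.
by apply/funext => x; rewrite deriveE// diff_lin.
Qed.

Lemma CkD V W k (U : set V) (f g : V -> W) : open U ->
  Ck k U f -> Ck k U g -> Ck k U (fun x => f x + g x).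
Proof.
move=> oU; elim: k f g => [|k IH] f g.
  move=> hf hg [|//] _ x Ux /=.
  by apply: differentiableD; [exact: (hf [::])|exact: (hg [::])].
move=> /CkS[df hf] /CkS[dg hg]; apply/CkS; split=> [x Ux|v].
  by apply: differentiableD; [exact: df|exact: dg].
apply: Ck_ext (IH _ _ (hf v) (hg v)) => // x Ux.
by rewrite -deriveD //; apply: diff_derivable; [exact: df|exact: dg].
Qed.

Lemma Ck_sum V W k (U : set V) (I : Type) (r : seq I) (P : pred I)
    (f : I -> V -> W) : open U -> (forall i, P i -> Ck k U (f i)) ->
  Ck k U (fun x => \sum_(i <- r | P i) f i x).
Proof.
move=> oU h; elim: r => [|i r IH].
  by under eq_fun do rewrite big_nil; exact: Ck_cst.
under eq_fun do rewrite big_cons.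
by have [Pi|//] := boolP (P i); apply: CkD => //; exact: h.
Qed.

Lemma CkZl V W k (U : set V) (f : V -> R) (w : W) : open U ->
  Ck k U f -> Ck k U (fun x => f x *: w).
Proof.
move=> oU; elim: k f => [|k IH] f.
  move=> hf [|//] _ x Ux /=; apply: differentiableZl; exact: (hf [::]).
move=> /CkS[df hf]; apply/CkS; split=> [x Ux|v].
  by apply: differentiableZl; exact: df.
apply: Ck_ext (IH _ (hf v)) => // x Ux.
have dfx := df x Ux; have dz := differentiableZl w dfx.
by rewrite !deriveE// diffZl.
Qed.

Lemma CkM V k (U : set V) (f g : V -> R) : open U ->
  Ck k U f -> Ck k U g -> Ck k U (fun x => f x * g x).
Proof.
move=> oU; elim: k f g => [|k IH] f g.
  move=> hf hg [|//] _ x Ux /=.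
  by apply: differentiableM; [exact: (hf [::])|exact: (hg [::])].
move=> kf kg; have /CkS[df hf] := kf; have /CkS[dg hg] := kg.
apply/CkS; split=> [x Ux|v].
  by apply: differentiableM; [exact: df|exact: dg].
apply: Ck_ext (CkD oU (IH _ _ (CkW kf) (hg v)) (IH _ _ (CkW kg) (hf v))) => //.
move=> x Ux.
by rewrite (deriveM (f := f) (g := g))//; apply: diff_derivable; [exact: df|exact: dg].
Qed.

Lemma CkN V k (U : set V) (f : V -> R) : open U ->
  Ck k U f -> Ck k U (fun x => - f x).
Proof.
move=> oU hf; under eq_fun do rewrite -mulN1r.
by apply: CkM => //; exact: Ck_cst.
Qed.

Lemma CkB V k (U : set V) (f g : V -> R) : open U ->
  Ck k U f -> Ck k U g -> Ck k U (fun x => f x - g x).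
Proof. by move=> oU hf hg; apply: CkD => //; exact: CkN. Qed.

Lemma CkX V k (U : set V) (f : V -> R) n : open U ->
  Ck k U f -> Ck k U (fun x => f x ^+ n).
Proof.
move=> oU hf; elim: n => [|n IH].
  by under eq_fun do rewrite expr0; exact: Ck_cst.
by under eq_fun do rewrite exprS; exact: CkM.
Qed.

Lemma Ck_comp V k (U : set V) (O : set R) (h : R -> R) (f : V -> R) :
  open U -> (forall x, U x -> O (f x)) ->
  Ck k O h -> Ck k U f -> Ck k U (fun x => h (f x)).
Proof.
move=> oU UO; elim: k h => [|k IH] h.
  move=> hh hf [|//] _ x Ux /=; apply: differentiable_comp.
    exact: (hf [::]).
  by apply: (hh [::]) => //; exact: UO.
move=> /CkS[dh hh] kf; have /CkS[df hf] := kf; apply/CkS; split=> [x Ux|v].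
  by apply: differentiable_comp; [exact: df|exact/dh/UO].
apply: Ck_ext (CkM oU (IH _ (hh 1) (CkW kf)) (hf v)) => // x Ux.
by rewrite (derive_comp (f := f) (h := h))//; [exact: df|exact/dh/UO].
Qed.

Lemma Ck_comp_linear V V' W k (f : V -> W) (L : {linear V' -> V}) :
  continuous L -> Ck k setT f -> Ck k setT (fun x => f (L x)).
Proof.
move=> Lc; have dL x : differentiable L x by exact: linear_differentiable.
elim: k f => [|k IH] f.
  move=> hf [|//] _ x _ /=; apply: differentiable_comp => //; exact: (hf [::]).
move=> /CkS[df hf]; apply/CkS; split=> [x _|v].
  by apply: differentiable_comp => //; exact: df.
rewrite (_ : 'D_v _ = fun x => 'D_(L v) f (L x)); first exact: IH (hf (L v)).
apply/funext => x; rewrite (deriveE (f := f \o L)); last first.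
  by apply: differentiable_comp => //; exact: df.
by rewrite diff_comp//=; [rewrite diff_lin// deriveE//; exact: df|exact: df].
Qed.

Lemma Ck_rV V k (U : set V) m (f : V -> 'rV[R]_m) : open U ->
  (forall j, Ck k U (fun x => f x 0 j)) -> Ck k U f.
Proof.
move=> oU h; rewrite (_ : f = fun x => \sum_j f x 0 j *: delta_mx 0 j).
  by apply: Ck_sum => // j _; exact: CkZl.
by apply/funext => x; exact: row_sum_delta.
Qed.

(** Bootstrap for families whose derivatives are expressed through the family: regularity [k] of all
    members gives regularity [k] of their derivatives, hence regularity [k.+1] of the members. It
    serves [cos] and [sin], the inverse, the square root and [flat]. *)
Lemma Ck_is_derive (O : set R) (I : Type) (F : I -> R -> R) :
  open O ->
  (forall i x, O x -> derivable (F i) x 1) ->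
  (forall k, (forall i, Ck k O (F i)) -> forall i, Ck k O ('D_1 (F i))) ->
  forall k i, Ck k O (F i).
Proof.
move=> oO dF hF; elim=> [|k IH] i.
  by move=> [|//] _ x Ox /=; exact/derivable1_diffP/dF.
apply/CkS; split=> [x Ox|v]; first exact/derivable1_diffP/dF.
apply: Ck_ext (CkM oO (@Ck_cst _ _ k O v) (hF k IH i)) => // x Ox.
have df : differentiable (F i) x by exact/derivable1_diffP/dF.
rewrite !deriveE// -[in RHS](mulr1 v) -[v * 1]/(v *: (1 : R^o)).
by rewrite linearZ.
Qed.

End SmoothCalculus.

(** * Rules for explicit directional derivatives *)

Section IsDerive.
Variables (R : realType) (V : normedModType R).
Implicit Types (f g : V -> R) (x v : V).

(** Restriction to a line reduces the chain rule to one real variable, so that a derivative along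
    [v] suffices and no total differential has to be supplied. *)
Lemma is_derive_lineP (W : normedModType R) (f : V -> W) x v (df : W) :
  is_derive x v f df <-> is_derive (0 : R) (1 : R) (fun h : R => f (h *: v + x)) df.
Proof.
suff E : (fun h : R => h^-1 *: ((f \o shift x) (h *: v) - f x)) =
    (fun h : R => h^-1 *: (((fun h : R => f (h *: v + x)) \o shift (0 : R)) (h *: (1 : R))
       - f (0 *: v + x))).
  by split=> -[d <-]; apply: DeriveDef; rewrite /derivable /derive E in d *.
by apply/funext => h /=; rewrite addr0 scale0r add0r [h%:A]mulr1.
Qed.

Lemma is_derive_compR (h : R -> R) f x v (dh df : R) :
  is_derive (f x) 1 h dh -> is_derive x v f df ->
  is_derive x v (fun y => h (f y)) (dh * df).
Proof.
move=> Hh /is_derive_lineP Hf; apply/is_derive_lineP.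
apply: (is_derive1_comp (f := h) (g := fun k : R => f (k *: v + x))).
by rewrite scale0r add0r.
Qed.

Lemma is_derive_add f g x v (df dg : R) :
  is_derive x v f df -> is_derive x v g dg ->
  is_derive x v (fun y => f y + g y) (df + dg).
Proof. exact: is_deriveD. Qed.

Lemma is_derive_sub f g x v (df dg : R) :
  is_derive x v f df -> is_derive x v g dg ->
  is_derive x v (fun y => f y - g y) (df - dg).
Proof. exact: is_deriveB. Qed.

Lemma is_derive_mul f g x v (df dg : R) :
  is_derive x v f df -> is_derive x v g dg ->
  is_derive x v (fun y => f y * g y) (df * g x + f x * dg).
Proof.
by move=> Hf Hg; rewrite addrC [df * _]mulrC; apply: (is_deriveM Hf Hg).
Qed.

Lemma is_derive_sqr f x v (df : R) :
  is_derive x v f df -> is_derive x v (fun y => f y ^+ 2) (2 * f x * df).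
Proof.
move=> Hf; rewrite (_ : 2 * f x * df = df * f x + f x * df); last by ring.
exact: (is_derive_mul Hf Hf).
Qed.

(** The quotient [f x / g x] is kept intact in the result, so that x_3 / |z_3| can later be
    abstracted as one component of a unit vector. *)
Lemma is_derive_div f g x v (df dg : R) : g x != 0 ->
  is_derive x v f df -> is_derive x v g dg ->
  is_derive x v (fun y => f y / g y) ((df - f x / g x * dg) / g x).
Proof.
move=> g0 Hf Hg.
have Hi : is_derive (g x) 1 (@GRing.inv R) (- (g x) ^- 2 *: 1).
  by apply: (@is_deriveV _ (@id R)).
apply: (is_derive_eq (is_derive_mul Hf (is_derive_compR Hi Hg))); rewrite /GRing.scale /=; field.
exact: g0.
Qed.

Lemma is_derive_bigsum (I : Type) (r : seq I) (P : pred I)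
    (F : I -> V -> R) (dF : I -> R) x v :
  (forall i, P i -> is_derive x v (F i) (dF i)) ->
  is_derive x v (fun y => \sum_(i <- r | P i) F i y) (\sum_(i <- r | P i) dF i).
Proof.
move=> H; elim: r => [|i r IH].
  by under eq_fun do rewrite big_nil; rewrite big_nil; exact: is_derive_cst.
under eq_fun do rewrite big_cons; rewrite big_cons.
by have [Pi|//] := boolP (P i); apply: is_derive_add => //; exact: H.
Qed.

Lemma is_derive_linear (W : normedModType R) (f : {linear V -> W}) x v :
  continuous f -> is_derive x v f (f v).
Proof.
move=> fc; have df : differentiable f x by exact/linear_differentiable.
by apply: DeriveDef; [exact: diff_derivable|rewrite deriveE// diff_lin].
Qed.

Lemma is_derive_rV m (f : V -> 'rV[R]_m) x v (df : 'rV[R]_m) :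
  (forall j, is_derive x v (fun y => f y 0 j) (df 0 j)) -> is_derive x v f df.
Proof.
move=> H; have d : derivable f x v.
  by apply/derivable_mxP => i j; rewrite ord1; have [] := H j.
apply: DeriveDef => //; rewrite derive_mx//; apply/rowP => j; rewrite mxE.
by have [] := H j.
Qed.

End IsDerive.

Section Coord.
Variable R : realType.

Lemma coord_linear m (j : 'I_m) : linear (fun x : 'rV[R]_m => x 0 j : R).
Proof. by move=> a u v; rewrite !mxE. Qed.

Definition coord_lin m (j : 'I_m) : {linear 'rV[R]_m -> R} :=
  HB.pack (fun x : 'rV[R]_m => x 0 j : R)
    (GRing.isLinear.Build _ _ _ _ _ (@coord_linear m j)).

Lemma is_derive_coord m (j : 'I_m) (x v : 'rV[R]_m) :
  is_derive x v (fun y => y 0 j) (v 0 j).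
Proof. by apply: (is_derive_linear (f := coord_lin j)); exact: coord_continuous. Qed.

Lemma Ck_coord k m (U : set 'rV[R]_m) (j : 'I_m) :
  Ck k U (fun x : 'rV[R]_m => x 0 j : R).
Proof. by apply: (Ck_linear (f := coord_lin j)); exact: coord_continuous. Qed.

End Coord.

(** * Smoothness of elementary functions and of a function flat at 0 *)

Section ScalarFunctions.
Variable R : realType.

Lemma open_gt0 : open [set x : R | 0 < x].
Proof. exact: open_gt. Qed.

Lemma Ck_sincos k : Ck k setT (@cos R) /\ Ck k setT (@sin R).
Proof.
pose F (b : bool) : R -> R := if b then cos else sin.
suff H : forall k b, Ck k setT (F b) by split; [exact: (H k true)|exact: (H k false)].
apply: Ck_is_derive => [|[] x _ /=|]; [exact: openT|by []|by []|].
move=> {}k IH [].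
  rewrite (_ : 'D_1 (F true) = fun x : R => - sin x); last first.
    by apply/funext => x; rewrite derive_val.
  apply: CkN; [exact: openT|exact: (IH false)].
rewrite (_ : 'D_1 (F false) = cos); first exact: (IH true).
by apply/funext => x; rewrite derive_val.
Qed.

Lemma Ck_inv k : Ck k [set x : R | 0 < x] (@GRing.inv R).
Proof.
have dinv (x : R) : 0 < x -> is_derive x 1 (@GRing.inv R) (- x^-1 ^+ 2).
  move=> x0; rewrite exprVn.
  have -> : - (x ^+ 2)^-1 = - x ^- 2 *: 1 by rewrite /GRing.scale /= mulr1.
  by apply: (@is_deriveV _ (@id R)); rewrite gt_eqF.
have oO := open_gt0.
apply: (@Ck_is_derive _ _ unit (fun=> @GRing.inv R)) (tt) => //.
  by move=> _ x x0; have [] := dinv x x0.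
move=> {}k IH _; apply: (Ck_ext (f := fun x : R => - x^-1 ^+ 2)) => //.
  by move=> x x0; have [_ ->] := dinv x x0.
by apply: CkN => //; apply: CkX => //; exact: IH.
Qed.

Lemma Ck_sqrt k : Ck k [set x : R | 0 < x] (@Num.sqrt R).
Proof.
have oO := open_gt0.
apply: (@Ck_is_derive _ _ unit (fun=> @Num.sqrt R)) (tt) => //.
  by move=> _ x x0; have [] := is_derive1_sqrt x0.
move=> {}k IH _; apply: (Ck_ext (f := fun x : R => (2 * Num.sqrt x)^-1)) => //.
  by move=> x x0; have [_ ->] := is_derive1_sqrt x0.
apply: (Ck_comp oO _ (@Ck_inv k)).
  by move=> x x0 /=; rewrite mulr_gt0// sqrtr_gt0.
by apply: CkM => //; [exact: Ck_cst|exact: IH].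
Qed.

(* Up to linear combinations this family is stable under derivation, so that
   flat 0, that is exp (- 1 / x) extended by 0 to x <= 0, is smooth. *)
Definition flat (m : nat) (x : R) : R :=
  if 0 < x then x^-1 ^+ m * expR (- x^-1) else 0.

(** This is exp y >= y^(m+2) / (m+2)! at y = 1/x. The left-hand side is the difference quotient at 0
    of [flat m], and the spare factor x makes it tend to 0. *)
Lemma flat_le m (x : R) : 0 < x ->
  x^-1 ^+ m.+1 * expR (- x^-1) <= (m.+2)`!%:R * x.
Proof.
move=> x0; have y0 : 0 < x^-1 by rewrite invr_gt0.
have h : x^-1 ^+ m.+2 / (m.+2)`!%:R <= expR x^-1.
  by apply: le_trans (expR_ge1Dxn m.+1 (ltW y0)); rewrite lerDr.
rewrite expRN ler_pdivrMr ?expR_gt0// -[leLHS]mulr1 -[X in _ * X](mulVf (lt0r_neq0 x0)).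
rewrite mulrA -exprSr [leRHS]mulrAC ler_pM2r//.
by rewrite mulrC -ler_pdivrMr ?ltr0n ?fact_gt0.
Qed.

Lemma flat_is_derive m (x : R) :
  is_derive x 1 (flat m) (- m%:R * flat m.+1 x + flat m.+2 x).
Proof.
have [x0|x0|<-] := ltgtP 0 x.
- have nf : \near x, x^-1 ^+ m * expR (- x^-1) = flat m x.
    near=> y; rewrite /flat ifT//; near: y; exact: lt_nbhsr.
  apply: near_eq_is_derive nf _.
  have dinv : is_derive x 1 (@GRing.inv R) (- x ^- 2 *: 1).
    by apply: (@is_deriveV _ (@id R)); rewrite gt_eqF.
  have -> : - m%:R * flat m.+1 x + flat m.+2 x =
     x^-1 ^+ m *: (expR (- x^-1) * - (- x ^- 2 *: 1)) +
     expR (- x^-1) *: (m%:R * x^-1 ^+ m.-1 *: (- x ^- 2 *: 1)).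
    rewrite /flat x0 /GRing.scale /=; case: m => [|m] /=; rewrite -?exprVn; first by ring.
    by move: (x^-1) (expR _) (m.+1%:R) => y E M; rewrite !exprS; ring.
  apply: is_deriveM.
    case: m => [|m].
      by rewrite mulr0n mul0r scale0r; exact: is_derive_cst.
    rewrite (_ : (fun _ => _) = (@GRing.inv R) ^+ m.+1); first exact: is_deriveX.
    by apply/funext => y; rewrite exprfctE.
- have nf : \near x, cst 0 x = flat m x.
    near=> y; rewrite /flat ifF//; apply/negbTE; rewrite -leNgt ltW//.
    by near: y; exact: lt_nbhsl.
  apply: near_eq_is_derive nf _.
  rewrite /flat ltNge (ltW x0) /= !mulr0 addr0; exact: is_derive_cst.
rewrite {2 3}/flat ltxx mulr0 addr0.
have C0 : 0 < (m.+2)`!%:R :> R by rewrite ltr0n fact_gt0.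
have lim0 : h^-1 *: (flat m (h *: 1 + 0) - flat m 0) @[h --> (0 : R)^'] --> (0 : R).
  apply/cvgrPdist_lt => e e0; near=> h.
  have h0 : h != 0 by near: h; exact: nbhs_dnbhs_neq.
  rewrite sub0r normrN addr0 /flat ltxx subr0 /GRing.scale /= mulr1.
  case: ifPn => hp; last by rewrite mulr0 normr0.
  rewrite mulrA -exprS ger0_norm; last first.
    by rewrite mulr_ge0 ?expR_ge0// exprn_ge0// invr_ge0 ltW.
  apply: le_lt_trans (flat_le m hp) _.
  rewrite mulrC -ltr_pdivlMr// -[h]ger0_norm ?ltW//.
  by near: h; apply: dnbhs0_lt; rewrite divr_gt0.
apply: DeriveDef; first by apply/cvg_ex; exists 0.
exact: cvg_lim lim0.
Unshelve. all: by end_near. Qed.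

Lemma Ck_flat k m : Ck k setT (flat m).
Proof.
move: k m; apply: Ck_is_derive; first exact: openT.
  by move=> m x _; have [] := flat_is_derive m x.
move=> k IH m; rewrite (_ : 'D_1 (flat m) = fun x => - m%:R * flat m.+1 x + flat m.+2 x).
  by have oT := @openT R; apply: CkD => //; apply: CkM => //; exact: Ck_cst.
by apply/funext => x; have [] := flat_is_derive m x.
Qed.

End ScalarFunctions.

(** * The Hamiltonian flow *)

Section Coordinates.
Variables (R : realType) (n : nat).
Local Notation V := 'rV[R]_(n + n).

Definition of_coords (x y : 'I_n -> R) : V := row_mx (\row_j x j) (\row_j y j).

Lemma xcoordE x y j : xcoord (of_coords x y) j = x j.
Proof. by rewrite /xcoord row_mxEl mxE. Qed.

Lemma ycoordE x y j : ycoord (of_coords x y) j = y j.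
Proof. by rewrite /ycoord row_mxEr mxE. Qed.

Lemma coordsP (z z' : V) : (forall j, xcoord z j = xcoord z' j) ->
  (forall j, ycoord z j = ycoord z' j) -> z = z'.
Proof.
move=> hx hy; apply/rowP => k.
by case: (split_ordP k) => j ->; [exact: hx|exact: hy].
Qed.

Definition sqnorm (z : V) j := xcoord z j ^+ 2 + ycoord z j ^+ 2.

Lemma sqnorm_ge0 z j : 0 <= sqnorm z j.
Proof. by rewrite addr_ge0 ?sqr_ge0. Qed.

(* z_j is multiplied by exp (- i a_j) *)
Definition rotate (a : 'I_n -> R) (z : V) : V := of_coords
  (fun j => cos (a j) * xcoord z j + sin (a j) * ycoord z j)
  (fun j => cos (a j) * ycoord z j - sin (a j) * xcoord z j).

Lemma sqnorm_rotate a z j : sqnorm (rotate a z) j = sqnorm z j.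
Proof. by rewrite /sqnorm xcoordE ycoordE; have := cos2Dsin2 (a j); nra. Qed.

Lemma rotate0 z : rotate (fun=> 0) z = z.
Proof.
by apply: coordsP => j; rewrite ?xcoordE ?ycoordE cos0 sin0 mul0r mul1r ?addr0 ?subr0.
Qed.

Lemma rotateD a b z : rotate a (rotate b z) = rotate (fun j => a j + b j) z.
Proof.
by apply: coordsP => j; rewrite !(xcoordE, ycoordE) cosD sinD; ring.
Qed.

End Coordinates.

(** * The explicit flow of H0 *)

Section Flow.
Variables (R : realType) (n : nat) (i1 i2 i3 : 'I_n).
Hypotheses (i12 : i1 != i2) (i13 : i1 != i3) (i23 : i2 != i3).
Local Notation V := 'rV[R]_(n + n).

Let i21 : (i2 == i1) = false. Proof. by rewrite eq_sym (negbTE i12). Qed.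
Let i31 : (i3 == i1) = false. Proof. by rewrite eq_sym (negbTE i13). Qed.
Let i32 : (i3 == i2) = false. Proof. by rewrite eq_sym (negbTE i23). Qed.
Let i12f : (i1 == i2) = false. Proof. exact: negbTE. Qed.
Let i13f : (i1 == i3) = false. Proof. exact: negbTE. Qed.
Let i23f : (i2 == i3) = false. Proof. exact: negbTE. Qed.
Let iE := (i21, i31, i32, i12f, i13f, i23f, eqxx).

(* moment z j is invariant under the flow of H0 for j <> i1: H0 is invariant
   under the torus action whose weights on (z_1, z_2, z_3) are orthogonal to
   (1, -1, -1). *)
Definition weight (j : 'I_n) : R := ((j == i2) || (j == i3))%:R.

Definition moment (z : V) j := sqnorm z j + weight j * sqnorm z i1.

(* u = z_3 / |z_3|, which is 0 when z_3 = 0 *)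
Definition r3 (z : V) := Num.sqrt (sqnorm z i3).
Definition ux (z : V) := xcoord z i3 / r3 z.
Definition uy (z : V) := ycoord z i3 / r3 z.

(* w = z_2 u and w' = z_1 u^-1 *)
Definition wx (z : V) := xcoord z i2 * ux z - ycoord z i2 * uy z.
Definition wy (z : V) := xcoord z i2 * uy z + ycoord z i2 * ux z.
Definition w'x (z : V) := xcoord z i1 * ux z + ycoord z i1 * uy z.
Definition w'y (z : V) := ycoord z i1 * ux z - xcoord z i1 * uy z.

(* real and imaginary parts of z_1 * conj z_2 * conj u *)
Definition H0 (z : V) := xcoord z i1 * wx z + ycoord z i1 * wy z.
Definition K0 (z : V) := ycoord z i1 * wx z - xcoord z i1 * wy z.

Definition swap_x1 t z := cos t * xcoord z i1 + sin t * wy z.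
Definition swap_y1 t z := cos t * ycoord z i1 - sin t * wx z.
Definition swap_sqnorm3 t z :=
  sqnorm z i3 + sqnorm z i1 - (swap_x1 t z ^+ 2 + swap_y1 t z ^+ 2).

(* The time t flow of H0: the argument of z_3 is constant and (z_1 u^-1, z_2)
   undergoes the rotation ((cos t, - i sin t), (- i sin t, cos t)) of SU(2); |z_3|
   is then given by the conservation of |z_1|^2 + |z_3|^2. *)
Definition swap (t : R) (z : V) : V := of_coords
  (fun j => if j == i1 then swap_x1 t z
     else if j == i2 then cos t * xcoord z i2 + sin t * w'y z
     else if j == i3 then ux z * Num.sqrt (swap_sqnorm3 t z) else xcoord z j)
  (fun j => if j == i1 then swap_y1 t z
     else if j == i2 then cos t * ycoord z i2 - sin t * w'x z
     else if j == i3 then uy z * Num.sqrt (swap_sqnorm3 t z) else ycoord z j).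

(* The flow of H0 preserves this set and never meets z_3 = 0 there, because it
   preserves |z_1|^2 + |z_2|^2 and |z_1|^2 + |z_3|^2, hence |z_3|^2 - |z_2|^2. *)
Definition good (z : V) : Prop := sqnorm z i2 < sqnorm z i3.

Lemma r3_gt0 z : good z -> 0 < r3 z.
Proof. by move=> h; rewrite sqrtr_gt0 (le_lt_trans _ h)// sqnorm_ge0. Qed.

Lemma r3K z : r3 z ^+ 2 = sqnorm z i3.
Proof. by rewrite sqr_sqrtr// sqnorm_ge0. Qed.

Lemma u_unit z : good z -> ux z ^+ 2 + uy z ^+ 2 = 1.
Proof.
move=> /r3_gt0 h; rewrite !expr_div_n -mulrDl r3K -/(sqnorm z i3) divff//.
by rewrite -r3K sqrf_eq0 gt_eqF.
Qed.

Lemma swap_sqnorm1 t z : sqnorm (swap t z) i1 = swap_x1 t z ^+ 2 + swap_y1 t z ^+ 2.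
Proof. by rewrite /sqnorm xcoordE ycoordE eqxx. Qed.

Lemma swap_sqnorm12 t z : good z ->
  sqnorm (swap t z) i1 + sqnorm (swap t z) i2 = sqnorm z i1 + sqnorm z i2.
Proof.
move=> /u_unit u1; rewrite /sqnorm !xcoordE !ycoordE !iE /swap_x1 /swap_y1.
rewrite /wx /wy /w'x /w'y; have := cos2Dsin2 t.
move: (cos t) (sin t) (ux z) (uy z) u1 => c s a b u1 cs.
move: (xcoord _ _) (ycoord _ _) (xcoord _ _) (ycoord _ _) => x1 y1 x2 y2.
transitivity ((c ^+ 2 + s ^+ 2 * (a ^+ 2 + b ^+ 2)) *
  (x1 ^+ 2 + y1 ^+ 2 + (x2 ^+ 2 + y2 ^+ 2))); first by ring.
by rewrite u1 mulr1 cs mul1r; ring.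
Qed.

(** By the two conservation laws the new value is |z_3|^2 - |z_2|^2 plus the new |z_2|^2. Hence the
    square root in [swap] is taken where it is smooth. *)
Lemma swap_sqnorm3_gt0 t z : good z -> 0 < swap_sqnorm3 t z.
Proof.
move=> zg; rewrite /swap_sqnorm3 -swap_sqnorm1.
have := swap_sqnorm12 t zg; have := sqnorm_ge0 (swap t z) i2; move: zg; rewrite /good.
lra.
Qed.

Lemma sqnorm3_swap t z : good z -> sqnorm (swap t z) i3 = swap_sqnorm3 t z.
Proof.
move=> zg; rewrite {1}/sqnorm xcoordE ycoordE !iE [(ux z * _) ^+ 2]exprMn.
rewrite [(uy z * _) ^+ 2]exprMn -mulrDl u_unit// mul1r.
by rewrite sqr_sqrtr// ltW// swap_sqnorm3_gt0.
Qed.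

Lemma r3_swap t z : good z -> r3 (swap t z) = Num.sqrt (swap_sqnorm3 t z).
Proof. by move=> zg; rewrite /r3 sqnorm3_swap. Qed.

Lemma ux_swap t z : good z -> ux (swap t z) = ux z.
Proof.
move=> zg; rewrite {1}/ux r3_swap// xcoordE !iE mulfK// gt_eqF// sqrtr_gt0.
exact: swap_sqnorm3_gt0.
Qed.

Lemma uy_swap t z : good z -> uy (swap t z) = uy z.
Proof.
move=> zg; rewrite {1}/uy r3_swap// ycoordE !iE mulfK// gt_eqF// sqrtr_gt0.
exact: swap_sqnorm3_gt0.
Qed.

Lemma sqnorm_swap_other t z j : j != i1 -> j != i2 -> j != i3 ->
  sqnorm (swap t z) j = sqnorm z j.
Proof.
by move=> /negbTE j1 /negbTE j2 /negbTE j3; rewrite /sqnorm xcoordE ycoordE j1 j2 j3.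
Qed.

Lemma good_swap t z : good z -> good (swap t z).
Proof.
move=> zg; have := swap_sqnorm12 t zg; move: (zg).
rewrite /good sqnorm3_swap// /swap_sqnorm3 -swap_sqnorm1; lra.
Qed.

Lemma moment_swap t z j : good z -> j != i1 -> moment (swap t z) j = moment z j.
Proof.
move=> zg j1; rewrite /moment /weight.
have [->|j2] := eqVneq j i2; first by have := swap_sqnorm12 t zg; rewrite /= !mul1r; lra.
have [->|j3] := eqVneq j i3.
  by rewrite sqnorm3_swap// /swap_sqnorm3 -swap_sqnorm1 /=; lra.
by rewrite sqnorm_swap_other// !mul0r.
Qed.

(** Since u is constant in time and |u| = 1, the pair (z_1, w) undergoes the same rotation as (w',
    z_2). This lemma and the next three give the components of w and w'; with them the group law of
    [swap] reduces to the addition formulas. *)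
Lemma wx_swap t z : good z -> wx (swap t z) = cos t * wx z + sin t * ycoord z i1.
Proof.
move=> zg; rewrite {1}/wx ux_swap// uy_swap// xcoordE ycoordE !iE /w'x /w'y /wx.
move/u_unit: zg; move: (ux z) (uy z) => a b ab.
rewrite -[X in _ = _ + _ * X]mul1r -ab; ring.
Qed.

Lemma wy_swap t z : good z -> wy (swap t z) = cos t * wy z - sin t * xcoord z i1.
Proof.
move=> zg; rewrite {1}/wy ux_swap// uy_swap// xcoordE ycoordE !iE /w'x /w'y /wy.
move/u_unit: zg; move: (ux z) (uy z) => a b ab.
rewrite -[X in _ = _ - _ * X]mul1r -ab; ring.
Qed.

Lemma w'x_swap t z : good z -> w'x (swap t z) = cos t * w'x z + sin t * ycoord z i2.
Proof.
move=> zg; rewrite {1}/w'x ux_swap// uy_swap// xcoordE ycoordE !iE /swap_x1 /swap_y1.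
rewrite /w'x /wx /wy; move/u_unit: zg; move: (ux z) (uy z) => a b ab.
rewrite -[X in _ = _ + _ * X]mul1r -ab; ring.
Qed.

Lemma w'y_swap t z : good z -> w'y (swap t z) = cos t * w'y z - sin t * xcoord z i2.
Proof.
move=> zg; rewrite {1}/w'y ux_swap// uy_swap// xcoordE ycoordE !iE /swap_x1 /swap_y1.
rewrite /w'y /wx /wy; move/u_unit: zg; move: (ux z) (uy z) => a b ab.
rewrite -[X in _ = _ - _ * X]mul1r -ab; ring.
Qed.

(** H0 is Re (z_1 conj w), the Hermitian form of the exchange matrix, and the rotation of (z_1, w)
    is an exponential of that matrix. *)
Lemma H0_swap t z : good z -> H0 (swap t z) = H0 z.
Proof.
move=> zg; rewrite /H0 wx_swap// wy_swap// xcoordE ycoordE !iE /swap_x1 /swap_y1.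
rewrite -[RHS]mul1r -(cos2Dsin2 t); ring.
Qed.

Lemma swap_x1D s t z : good z -> swap_x1 s (swap t z) = swap_x1 (s + t) z.
Proof.
move=> zg; rewrite /swap_x1 wy_swap// xcoordE !iE /swap_x1 cosD sinD; ring.
Qed.

Lemma swap_y1D s t z : good z -> swap_y1 s (swap t z) = swap_y1 (s + t) z.
Proof.
move=> zg; rewrite /swap_y1 wx_swap// ycoordE !iE /swap_y1 cosD sinD; ring.
Qed.

Lemma swap_sqnorm3D s t z : good z ->
  swap_sqnorm3 s (swap t z) = swap_sqnorm3 (s + t) z.
Proof.
move=> zg; rewrite {1}/swap_sqnorm3 swap_x1D// swap_y1D// sqnorm3_swap//.
by rewrite /swap_sqnorm3 swap_sqnorm1; ring.
Qed.

Lemma swapD s t z : good z -> swap s (swap t z) = swap (s + t) z.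
Proof.
move=> zg; apply: coordsP => j; rewrite ?[in LHS]xcoordE ?[in RHS]xcoordE
    ?[in LHS]ycoordE ?[in RHS]ycoordE.
  have [_|_] := eqVneq j i1; first exact: swap_x1D.
  have [_|_] := eqVneq j i2.
    by rewrite w'y_swap// !iE cosD sinD; ring.
  have [_|_] := eqVneq j i3; first by rewrite ux_swap// swap_sqnorm3D.
  by [].
have [_|_] := eqVneq j i1; first exact: swap_y1D.
have [_|_] := eqVneq j i2.
  by rewrite w'x_swap// !iE cosD sinD; ring.
have [_|_] := eqVneq j i3; first by rewrite uy_swap// swap_sqnorm3D.
by [].
Qed.

Lemma swap_sqnorm3_0 z : swap_sqnorm3 0 z = sqnorm z i3.
Proof. by rewrite /swap_sqnorm3 /swap_x1 /swap_y1 cos0 sin0 /sqnorm; ring. Qed.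

Lemma swap0 z : swap 0 z = z.
Proof.
have h3 := swap_sqnorm3_0 z.
(* When z_3 = 0 the convention x / 0 = 0 gives u = 0, which restores z_3 = 0. This case occurs
   because the identity is also used outside [good], where the flow is trivial. *)
have [r0|r0] := eqVneq (r3 z) 0.
  have := r3K z; rewrite r0 expr0n /= => /esym /eqP.
  rewrite paddr_eq0 ?sqr_ge0// !sqrf_eq0 => /andP[/eqP x0 /eqP y0].
  apply: coordsP => j; rewrite ?xcoordE ?ycoordE h3 -/(r3 z) r0 !mulr0.
    case: eqP => [->|_]; first by rewrite /swap_x1 cos0 sin0; ring.
    case: eqP => [->|_]; first by rewrite cos0 sin0; ring.
    by case: eqP => [->|_].
  case: eqP => [->|_]; first by rewrite /swap_y1 cos0 sin0; ring.
  case: eqP => [->|_]; first by rewrite cos0 sin0; ring.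
  by case: eqP => [->|_].
apply: coordsP => j; rewrite ?xcoordE ?ycoordE h3 -/(r3 z) ?divfK//.
  case: eqP => [->|_]; first by rewrite /swap_x1 cos0 sin0; ring.
  case: eqP => [->|_]; first by rewrite cos0 sin0; ring.
  by case: eqP => [->|_].
case: eqP => [->|_]; first by rewrite /swap_y1 cos0 sin0; ring.
case: eqP => [->|_]; first by rewrite cos0 sin0; ring.
by case: eqP => [->|_].
Qed.

(** * Invariance of H0 under the torus action *)

Section Rotate.
Variable a : 'I_n -> R.
Hypothesis ha : a i1 = a i2 + a i3.

Lemma r3_rotate z : r3 (rotate a z) = r3 z.
Proof. by rewrite /r3 sqnorm_rotate. Qed.

Lemma ux_rotate z : ux (rotate a z) = cos (a i3) * ux z + sin (a i3) * uy z.
Proof. by rewrite /ux /uy r3_rotate xcoordE mulrDl !mulrA. Qed.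

Lemma uy_rotate z : uy (rotate a z) = cos (a i3) * uy z - sin (a i3) * ux z.
Proof. by rewrite /ux /uy r3_rotate ycoordE mulrBl !mulrA. Qed.

Lemma wx_rotate z : wx (rotate a z) = cos (a i1) * wx z + sin (a i1) * wy z.
Proof.
rewrite /wx /wy ux_rotate uy_rotate xcoordE ycoordE ha cosD sinD; ring.
Qed.

Lemma wy_rotate z : wy (rotate a z) = cos (a i1) * wy z - sin (a i1) * wx z.
Proof.
rewrite /wx /wy ux_rotate uy_rotate xcoordE ycoordE ha cosD sinD; ring.
Qed.

Lemma w'x_rotate z : w'x (rotate a z) = cos (a i2) * w'x z + sin (a i2) * w'y z.
Proof.
have -> : a i2 = a i1 - a i3 by rewrite ha addrK.
rewrite /w'x /w'y ux_rotate uy_rotate xcoordE ycoordE cosB sinB; ring.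
Qed.

Lemma w'y_rotate z : w'y (rotate a z) = cos (a i2) * w'y z - sin (a i2) * w'x z.
Proof.
have -> : a i2 = a i1 - a i3 by rewrite ha addrK.
rewrite /w'x /w'y ux_rotate uy_rotate xcoordE ycoordE cosB sinB; ring.
Qed.

Lemma H0_rotate z : H0 (rotate a z) = H0 z.
Proof.
rewrite /H0 wx_rotate wy_rotate xcoordE ycoordE -[RHS]mul1r -(cos2Dsin2 (a i1)).
ring.
Qed.

Lemma good_rotate z : good (rotate a z) = good z.
Proof. by rewrite /good !sqnorm_rotate. Qed.

Lemma moment_rotate z j : moment (rotate a z) j = moment z j.
Proof. by rewrite /moment !sqnorm_rotate. Qed.

Lemma swap_x1_rotate t z :
  swap_x1 t (rotate a z) = cos (a i1) * swap_x1 t z + sin (a i1) * swap_y1 t z.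
Proof. by rewrite /swap_x1 /swap_y1 wy_rotate xcoordE; ring. Qed.

Lemma swap_y1_rotate t z :
  swap_y1 t (rotate a z) = cos (a i1) * swap_y1 t z - sin (a i1) * swap_x1 t z.
Proof. by rewrite /swap_x1 /swap_y1 wx_rotate ycoordE; ring. Qed.

Lemma swap_sqnorm3_rotate t z : swap_sqnorm3 t (rotate a z) = swap_sqnorm3 t z.
Proof.
rewrite /swap_sqnorm3 !sqnorm_rotate swap_x1_rotate swap_y1_rotate.
have := cos2Dsin2 (a i1); move: (cos _) (sin _) (swap_x1 _ _) (swap_y1 _ _).
move=> c s x y cs; congr (_ - _); rewrite -[RHS]mul1r -cs; ring.
Qed.

(** By the relation between the angles, u, w and w' are multiplied by the same phases as z_3, z_1
    and z_2 respectively, so every component of [swap] is equivariant. *)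
Lemma swap_rotate t z : swap t (rotate a z) = rotate a (swap t z).
Proof.
apply: coordsP => j; rewrite !(xcoordE, ycoordE).
  have [->|_] := eqVneq j i1; first exact: swap_x1_rotate.
  have [->|_] := eqVneq j i2; first by rewrite w'y_rotate; ring.
  have [->|_] := eqVneq j i3; first by rewrite ux_rotate swap_sqnorm3_rotate; ring.
  by [].
have [->|_] := eqVneq j i1; first exact: swap_y1_rotate.
have [->|_] := eqVneq j i2; first by rewrite w'x_rotate; ring.
have [->|_] := eqVneq j i3; first by rewrite uy_rotate swap_sqnorm3_rotate; ring.
by [].
Qed.

End Rotate.

(** * The flow of g(Q) H0 *)

Section TimeFlow.
Variables (m0 : 'I_n -> R) (g : R -> R) (eps : R).
Hypothesis g_eps : forall s, eps < s -> g s = 0 /\ 'D_1 g s = 0.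

Definition dmoment (z : V) j := moment z j - m0 j.
Definition Q (z : V) := \sum_(j | j != i1) dmoment z j ^+ 2.
Hypothesis good_eps : forall z, Q z <= eps -> good z.

(* Along the flow of g(Q) H0 both Q and H0 are constant, so that it is the flow of
   g(Q) H0 with g(Q) frozen, composed with the rotations generated by g'(Q) H0 Q
   with g'(Q) H0 frozen; these have the following frequencies. *)
Definition freq (z : V) j := 4 * ('D_1 g (Q z) * H0 z) *
  (if j == i1 then \sum_(l | l != i1) weight l * dmoment z l else dmoment z j).

Definition flow (t : R) (z : V) :=
  rotate (fun j => t * freq z j) (swap (t * g (Q z)) z).

Lemma sum_weight (F : 'I_n -> R) :
  \sum_(l | l != i1) weight l * F l = F i2 + F i3.
Proof.
rewrite (bigD1 i2) /=; last by rewrite eq_sym.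
rewrite (bigD1 i3) /=; last by rewrite eq_sym i13 eq_sym.
rewrite big1 ?addr0 => [|j]; last first.
  by rewrite /weight => /andP[/andP[_ /negbTE ->] /negbTE ->]; rewrite mul0r.
by rewrite /weight !eqxx orbT !mul1r.
Qed.

Lemma freqE z : freq z i1 = freq z i2 + freq z i3.
Proof. by rewrite /freq !iE sum_weight; ring. Qed.

(** Both alternatives are open conditions, so regularity can be checked on each separately: by the
    formula on [good], and where eps < Q because the flow is the identity and the Hamiltonian is
    0. *)
Lemma good_or_far z : good z \/ eps < Q z.
Proof. by case: (leP (Q z) eps) => [/good_eps|]; [left|right]. Qed.

Lemma g_bad z : ~ good z -> g (Q z) = 0 /\ 'D_1 g (Q z) = 0.
Proof. by move=> zb; apply: g_eps; case: (good_or_far z). Qed.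

Lemma flow_far t z : eps < Q z -> flow t z = z.
Proof.
move=> /g_eps[g0 dg0].
rewrite /flow g0 mulr0 swap0 -[RHS]rotate0; congr rotate; apply/funext => j.
by rewrite /freq dg0 mul0r mulr0 mul0r mulr0.
Qed.

Lemma flow_bad t z : ~ good z -> flow t z = z.
Proof. by move=> zb; apply: flow_far; case: (good_or_far z). Qed.

Lemma freqtE t z : t * freq z i1 = t * freq z i2 + t * freq z i3.
Proof. by rewrite freqE mulrDr. Qed.

Lemma H0_flow t z : good z -> H0 (flow t z) = H0 z.
Proof. by move=> zg; rewrite /flow H0_rotate ?H0_swap//; exact: freqtE. Qed.

Lemma dmoment_flow t z j : good z -> j != i1 -> dmoment (flow t z) j = dmoment z j.
Proof. by move=> zg j1; rewrite /dmoment moment_rotate moment_swap. Qed.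

Lemma Q_flow t z : good z -> Q (flow t z) = Q z.
Proof. by move=> zg; apply: eq_bigr => j j1; rewrite dmoment_flow. Qed.

Lemma freq_flow t z : good z -> freq (flow t z) = freq z.
Proof.
move=> zg; apply/funext => j; rewrite /freq Q_flow// H0_flow//.
case: eqVneq => [_|j1]; last by rewrite dmoment_flow.
by congr (_ * _); apply: eq_bigr => l l1; rewrite dmoment_flow.
Qed.

(** The speed g(Q) and the frequencies depend only on conserved quantities, so they agree at both
    stages; it remains to move [swap] past a rotation. The law yields the inverse [flow (-1)] and
    reduces the velocity to time 0. *)
Lemma flowD s t z : flow s (flow t z) = flow (s + t) z.
Proof.
have [zg|zb] := pselect (good z); last by rewrite !flow_bad.
rewrite {1}/flow freq_flow// Q_flow// /flow swap_rotate; last exact: freqtE.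
rewrite swapD// rotateD mulrDl; congr rotate; apply/funext => j; ring.
Qed.

Lemma flow0 z : flow 0 z = z.
Proof.
rewrite /flow mul0r swap0 -[RHS]rotate0; congr rotate; apply/funext => j.
by rewrite mul0r.
Qed.

(** With [swap_dy], the velocity of [swap] at time 0. The factor [K0 z / r3 z] is the derivative of
    |z_3|, which comes from the conservation of |z_1|^2 + |z_3|^2. *)
Definition swap_dx (z : V) j :=
  if j == i1 then wy z else if j == i2 then w'y z
  else if j == i3 then ux z * (K0 z / r3 z) else 0.
Definition swap_dy (z : V) j :=
  if j == i1 then - wx z else if j == i2 then - w'x z
  else if j == i3 then uy z * (K0 z / r3 z) else 0.

Definition flow_vf (z : V) : V := of_coords
  (fun j => freq z j * ycoord z j + g (Q z) * swap_dx z j)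
  (fun j => - (freq z j * xcoord z j) + g (Q z) * swap_dy z j).

(** * Velocity of the flow *)

Lemma is_derive_cosM (c : R) : is_derive (0 : R) 1 (fun t => cos (t * c)) 0.
Proof.
apply: (is_derive_eq (is_derive_compR (is_derive_cos _)
  (is_derive_mul (is_derive_id _ _) (is_derive_cst c _ _)))).
by rewrite mul0r sin0 oppr0 mul0r.
Qed.

Lemma is_derive_sinM (c : R) : is_derive (0 : R) 1 (fun t => sin (t * c)) c.
Proof.
apply: (is_derive_eq (is_derive_compR (is_derive_sin _)
  (is_derive_mul (is_derive_id _ _) (is_derive_cst c _ _)))).
by rewrite mul0r cos0 !mul1r mul0r addr0.
Qed.

Lemma is_derive_rotx (c : R) (p q : R -> R) (dp dq : R) :
  is_derive (0 : R) 1 p dp -> is_derive (0 : R) 1 q dq ->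
  is_derive (0 : R) 1 (fun t => cos (t * c) * p t + sin (t * c) * q t) (dp + c * q 0).
Proof.
move=> Hp Hq; apply: (is_derive_eq (is_derive_add
  (is_derive_mul (is_derive_cosM c) Hp) (is_derive_mul (is_derive_sinM c) Hq))).
by rewrite !mul0r cos0 sin0; ring.
Qed.

Lemma is_derive_roty (c : R) (p q : R -> R) (dp dq : R) :
  is_derive (0 : R) 1 p dp -> is_derive (0 : R) 1 q dq ->
  is_derive (0 : R) 1 (fun t => cos (t * c) * q t - sin (t * c) * p t) (dq - c * p 0).
Proof.
move=> Hp Hq; apply: (is_derive_eq (is_derive_sub
  (is_derive_mul (is_derive_cosM c) Hq) (is_derive_mul (is_derive_sinM c) Hp))).
by rewrite !mul0r cos0 sin0; ring.
Qed.

Lemma is_derive_swap_x1 c z :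
  is_derive (0 : R) 1 (fun t => swap_x1 (t * c) z) (c * wy z).
Proof.
apply: (is_derive_eq (is_derive_rotx c (is_derive_cst (xcoord z i1) _ _)
  (is_derive_cst (wy z) _ _))); rewrite /cst /=; ring.
Qed.

Lemma is_derive_swap_y1 c z :
  is_derive (0 : R) 1 (fun t => swap_y1 (t * c) z) (- (c * wx z)).
Proof.
apply: (is_derive_eq (is_derive_roty c (is_derive_cst (wx z) _ _)
  (is_derive_cst (ycoord z i1) _ _))); rewrite /cst /=; ring.
Qed.

Lemma is_derive_swap_r3 c z : good z ->
  is_derive (0 : R) 1 (fun t => Num.sqrt (swap_sqnorm3 (t * c) z)) (c * (K0 z / r3 z)).
Proof.
move=> zg; have r0 := r3_gt0 zg.
have n0 : 0 < swap_sqnorm3 (0 * c) z by rewrite mul0r swap_sqnorm3_0 -r3K exprn_gt0.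
have Dn := is_derive_sub (is_derive_cst (sqnorm z i3 + sqnorm z i1) _ _)
   (is_derive_add (is_derive_sqr (is_derive_swap_x1 c z))
     (is_derive_sqr (is_derive_swap_y1 c z))).

refine (is_derive_eq (is_derive_compR (f := fun t : R => swap_sqnorm3 (t * c) z)
  (is_derive1_sqrt n0) Dn) _).
rewrite !mul0r swap_sqnorm3_0 -/(r3 z) /swap_x1 /swap_y1 cos0 sin0 /K0.
by field; rewrite gt_eqF.
Qed.

Lemma is_derive_swapx c z j : good z ->
  is_derive (0 : R) 1 (fun t => xcoord (swap (t * c) z) j) (c * swap_dx z j).
Proof.
move=> zg; under eq_fun do rewrite xcoordE; rewrite /swap_dx.
case: eqP => _; first exact: is_derive_swap_x1.
case: eqP => _.
  apply: (is_derive_eq (is_derive_rotx c (is_derive_cst (xcoord z i2) _ _)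
    (is_derive_cst (w'y z) _ _))); rewrite /cst /=; ring.
case: eqP => _; last by rewrite mulr0; exact: is_derive_cst.
apply: (is_derive_eq (is_derive_mul (is_derive_cst (ux z) _ _)
  (is_derive_swap_r3 c zg))); rewrite /cst /=; ring.
Qed.

Lemma is_derive_swapy c z j : good z ->
  is_derive (0 : R) 1 (fun t => ycoord (swap (t * c) z) j) (c * swap_dy z j).
Proof.
move=> zg; under eq_fun do rewrite ycoordE; rewrite /swap_dy.
case: eqP => _; first by rewrite mulrN; exact: is_derive_swap_y1.
case: eqP => _.
  apply: (is_derive_eq (is_derive_roty c (is_derive_cst (w'x z) _ _)
    (is_derive_cst (ycoord z i2) _ _))); rewrite /cst /=; ring.
case: eqP => _; last by rewrite mulr0; exact: is_derive_cst.
apply: (is_derive_eq (is_derive_mul (is_derive_cst (uy z) _ _)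
  (is_derive_swap_r3 c zg))); rewrite /cst /=; ring.
Qed.

Lemma flow_vf_bad z : ~ good z -> flow_vf z = 0.
Proof.
move=> /g_bad[g0 dg0]; apply: coordsP => j; rewrite ?xcoordE ?ycoordE /freq g0 dg0.
  by rewrite /xcoord mxE; ring.
by rewrite /ycoord mxE; ring.
Qed.

Lemma is_derive_flow z : is_derive (0 : R) 1 (fun t => flow t z) (flow_vf z).
Proof.
have [zg|zb] := pselect (good z); last first.
  rewrite flow_vf_bad//; under eq_fun do rewrite (flow_bad _ zb).
  exact: is_derive_cst.
apply: is_derive_rV => k; case: (split_ordP k) => j ->.
  rewrite -!/(xcoord _ j) xcoordE; under eq_fun do rewrite -!/(xcoord _ j) xcoordE.
  apply: (is_derive_eq (is_derive_rotx (freq z j) (is_derive_swapx (g (Q z)) j zg)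
    (is_derive_swapy (g (Q z)) j zg))).
  by rewrite mul0r swap0; ring.
rewrite -!/(ycoord _ j) ycoordE; under eq_fun do rewrite -!/(ycoord _ j) ycoordE.
apply: (is_derive_eq (is_derive_roty (freq z j) (is_derive_swapx (g (Q z)) j zg)
  (is_derive_swapy (g (Q z)) j zg))).
by rewrite mul0r swap0; ring.
Qed.

(** The group law moves the quotient to time 0, where the two-sided derivative is known. Restricting
    to A covers the one-sided limits at the ends of [0,1]. *)
Lemma flow_cvg t z (A : set R) :
  h^-1 *: (flow (t + h) z - flow t z) @[h --> within A (0 : R)^']
    --> flow_vf (flow t z).
Proof.
have [d dE] := is_derive_flow (flow t z).
have H : h^-1 *: (flow (t + h) z - flow t z) @[h --> (0 : R)^'] --> flow_vf (flow t z).
  rewrite (_ : (fun h => _) = (fun h : R => h^-1 *: (((fun s => flow s (flow t z)) \o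
    shift (0 : R)) (h *: (1 : R)) - flow 0 (flow t z)))); first by rewrite -dE; exact: d.
  by apply/funext => h; rewrite /= addr0 [h%:A]mulr1 flow0 flowD (addrC h t).
apply: cvg_trans H; apply: cvg_app; exact: cvg_within.
Qed.

Definition ham (z : V) := g (Q z) * H0 z.

Hypothesis g_smooth : forall k, Ck k setT g.

Lemma g_diff s : differentiable g s.
Proof. by apply: (Ck_diff (k := 0) (U := setT)) => //; exact: g_smooth. Qed.

Lemma Ck_xcoord k (U : set V) j : Ck k U (fun z => xcoord z j).
Proof. exact: Ck_coord. Qed.

Lemma Ck_ycoord k (U : set V) j : Ck k U (fun z => ycoord z j).
Proof. exact: Ck_coord. Qed.

Lemma Ck_sqnorm k (U : set V) j : open U -> Ck k U (fun z => sqnorm z j).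
Proof.
by move=> oU; apply: CkD => //; apply: CkX => //; [exact: Ck_xcoord|exact: Ck_ycoord].
Qed.

Lemma Ck_dmoment k (U : set V) j : open U -> Ck k U (fun z => dmoment z j).
Proof.
move=> oU; apply: CkB => //; last exact: Ck_cst.
apply: CkD => //; first exact: Ck_sqnorm.
by apply: CkM => //; [exact: Ck_cst|exact: Ck_sqnorm].
Qed.

Lemma Ck_Q k (U : set V) : open U -> Ck k U Q.
Proof.
by move=> oU; apply: Ck_sum => // j _; apply: CkX => //; exact: Ck_dmoment.
Qed.

Lemma open_above (f : V -> R) (c : R) : (forall z, differentiable f z) ->
  open [set z | c < f z].
Proof.
move=> df; apply: (open_comp (f := f) (D := [set x | c < x])); last exact: open_gt.
by move=> z _; exact: differentiable_continuous.
Qed.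

Lemma open_good : open good.
Proof.
rewrite (_ : good = [set z | 0 < sqnorm z i3 - sqnorm z i2]); last first.
  by apply/funext => z; rewrite /good /mkset subr_gt0.
have oT := @openT V; apply: open_above => z.
by apply: (@Ck_diff _ _ _ 0 setT) => //; apply: CkB => //; exact: Ck_sqnorm.
Qed.

Lemma open_far : open [set z | eps < Q z].
Proof.
have oT := @openT V; apply: open_above => z.
by apply: (@Ck_diff _ _ _ 0 setT) => //; exact: Ck_Q.
Qed.

(** * Hamilton's equation for g(Q) H0 *)

Lemma is_derive_xcoord (j : 'I_n) (z v : V) :
  is_derive z v (fun z => xcoord z j) (xcoord v j).
Proof. exact: is_derive_coord. Qed.

Lemma is_derive_ycoord (j : 'I_n) (z v : V) :
  is_derive z v (fun z => ycoord z j) (ycoord v j).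
Proof. exact: is_derive_coord. Qed.

Definition dsqnorm (z v : V) j := 2 * (xcoord z j * xcoord v j + ycoord z j * ycoord v j).

Lemma is_derive_sqnorm (j : 'I_n) (z v : V) :
  is_derive z v (fun z => sqnorm z j) (dsqnorm z v j).
Proof.
apply: (is_derive_eq (is_derive_add (is_derive_sqr (is_derive_xcoord j z v))
  (is_derive_sqr (is_derive_ycoord j z v)))).
by rewrite /dsqnorm; ring.
Qed.

Lemma is_derive_Q (z v : V) : is_derive z v Q
  (\sum_(j | j != i1) 2 * dmoment z j * (dsqnorm z v j + weight j * dsqnorm z v i1)).
Proof.
apply: is_derive_bigsum => j _; apply: is_derive_sqr.
apply: (is_derive_eq (is_derive_sub (is_derive_add (is_derive_sqnorm j z v)
  (is_derive_mul (is_derive_cst (weight j) _ _) (is_derive_sqnorm i1 z v)))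
  (is_derive_cst (m0 j) _ _))); rewrite /cst /=; ring.
Qed.

(** The pairing by [omega0] of the velocity of [swap] with [v]; that it is the differential of H0 is
    Hamilton's equation for [swap]. *)
Definition dH0 (z v : V) := \sum_j (swap_dx z j * ycoord v j - swap_dy z j * xcoord v j).

Lemma is_derive_r3 (z v : V) : good z ->
  is_derive z v r3 (dsqnorm z v i3 / (2 * r3 z)).
Proof.
move=> zg; have n0 : 0 < sqnorm z i3 by rewrite -r3K exprn_gt0// r3_gt0.
refine (is_derive_eq (is_derive_compR (f := fun z : V => sqnorm z i3)
  (is_derive1_sqrt n0) (is_derive_sqnorm i3 z v)) _).
by rewrite mulrC.
Qed.

Lemma is_derive_H0 (z v : V) : good z -> is_derive z v H0 (dH0 z v).
Proof.
move=> zg; have r0 := r3_gt0 zg; have rn0 : r3 z != 0 by rewrite gt_eqF.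
have Dx := is_derive_xcoord^~ z ^~ v.
have Dy := is_derive_ycoord^~ z ^~ v.
have Du := is_derive_div rn0 (Dx i3) (is_derive_r3 v zg).
have Dv := is_derive_div rn0 (Dy i3) (is_derive_r3 v zg).
have Dwx := is_derive_sub (is_derive_mul (Dx i2) Du) (is_derive_mul (Dy i2) Dv).
have Dwy := is_derive_add (is_derive_mul (Dx i2) Dv) (is_derive_mul (Dy i2) Du).
apply: (is_derive_eq (is_derive_add (is_derive_mul (Dx i1) Dwx)
  (is_derive_mul (Dy i1) Dwy))).
rewrite /dH0 (bigD1 i1)//= (bigD1 i2)/= ?(eq_sym i2)//.
rewrite (bigD1 i3)/=; last by rewrite !(eq_sym i3) i13.
rewrite big1 ?addr0 => [|j /andP[/andP[/negbTE j1 /negbTE j2] /negbTE j3]]; last first.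
  by rewrite /swap_dx /swap_dy j1 j2 j3 !mul0r subr0.
rewrite /swap_dx /swap_dy !iE /K0 /wx /wy /w'x /w'y /ux /uy /dsqnorm.
have r2 := r3K z; rewrite /sqnorm in r2.
move: (r3 z) rn0 r2 {Dx Dy Du Dv Dwx Dwy r0} => r rn0 r2.
move: (xcoord z i1) (ycoord z i1) (xcoord z i2) (ycoord z i2) => x1 y1 x2 y2.
move: (xcoord z i3) (ycoord z i3) r2 => x3 y3 r2.
move: (xcoord v i1) (ycoord v i1) (xcoord v i2) (ycoord v i2) (xcoord v i3) (ycoord v i3).
move=> a1 b1 a2 b2 a3 b3.
have uu : (x3 / r) ^+ 2 + (y3 / r) ^+ 2 = 1.
  by rewrite !expr_div_n -mulrDl -r2 divff// sqrf_eq0.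
have -> : 2 * (x3 * a3 + y3 * b3) / (2 * r) = x3 / r * a3 + y3 / r * b3 by field.
move: (x3 / r) (y3 / r) uu => a b uu.
(* In the differential of u = (a, b) the radial part of (a3, b3) drops out: a unit vector varies
   tangentially to the circle. *)
have -> : a3 - a * (a * a3 + b * b3) = b * (b * a3 - a * b3).
  by rewrite -{1}[a3]mul1r -uu; ring.
have -> : b3 - b * (a * a3 + b * b3) = a * (a * b3 - b * a3).
  by rewrite -{1}[b3]mul1r -uu; ring.
by move: (r^-1) => ri; ring.
Qed.

Lemma is_derive_ham (z v : V) : is_derive z v ham (omega0 (flow_vf z) v).
Proof.
have [zg|zb] := pselect (good z).
  have Dg : is_derive (Q z) 1 g ('D_1 g (Q z)) by exact/derivableP/diff_derivable/g_diff.
  apply: (is_derive_eq (is_derive_mul (is_derive_compR (f := Q) Dg (is_derive_Q z v))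
    (is_derive_H0 v zg))).
  (* A rotation of frequency f in the j-th plane pairs with [v] to f * [dsqnorm z v j] / 2. This 2
     and the one from differentiating the squares in Q make up the factor 4 in [freq]. *)
  transitivity (\sum_j (freq z j * (dsqnorm z v j / 2) + g (Q z) *
     (swap_dx z j * ycoord v j - swap_dy z j * xcoord v j))); last first.
    by apply: eq_bigr => j _; rewrite xcoordE ycoordE /dsqnorm; field.
  rewrite big_split/= -mulr_sumr -/(dH0 z v); congr (_ + _).
  have f1 : freq z i1 = \sum_(j | j != i1)
      4 * ('D_1 g (Q z) * H0 z) * (weight j * dmoment z j).
    by rewrite /freq eqxx mulr_sumr.
  rewrite [RHS](bigD1 i1)//= f1 mulr_suml -big_split/= mulr_sumr mulr_suml.
  by apply: eq_bigr => j /negbTE j1; rewrite /freq j1; field.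
(* A point outside [good] satisfies the open condition eps < Q, so [ham] vanishes on a whole
   neighbourhood of it. *)
rewrite flow_vf_bad// /omega0 big1 => [|j _]; last first.
  by rewrite /xcoord /ycoord !mxE !mul0r subrr.
have far : eps < Q z by case: (good_or_far z).
have nf : \near z, cst 0 z = ham z.
  have := open_nbhs_nbhs (conj open_far far); apply: filterS => y /g_eps[gy _].
  by rewrite /ham gy mul0r.
apply: near_eq_is_derive nf _; exact: is_derive_cst.
Qed.

Lemma ham_vf (z v : V) : omega0 (flow_vf z) v = 'D_v ham z.
Proof. by have [] := is_derive_ham z v. Qed.

(** * Smoothness of the flow and compactness of the support *)

Lemma Ck_r3 k : Ck k good r3.
Proof.
have og := open_good; apply: (Ck_comp (O := [set x | 0 < x]) og); last exact: Ck_sqnorm.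
  by move=> z zg /=; rewrite -r3K; apply: exprn_gt0; exact: r3_gt0.
exact: Ck_sqrt.
Qed.

Lemma Ck_r3V k : Ck k good (fun z => (r3 z)^-1).
Proof.
have og := open_good; apply: (Ck_comp (O := [set x | 0 < x]) og); last exact: Ck_r3.
  by move=> z zg /=; exact: r3_gt0.
exact: Ck_inv.
Qed.

Lemma Ck_ux k : Ck k good ux.
Proof. by apply: CkM; [exact: open_good|exact: Ck_xcoord|exact: Ck_r3V]. Qed.

Lemma Ck_uy k : Ck k good uy.
Proof. by apply: CkM; [exact: open_good|exact: Ck_ycoord|exact: Ck_r3V]. Qed.

Local Ltac Ck_tac := repeat first
  [ exact: open_good | exact: Ck_ux | exact: Ck_uy | exact: Ck_cst
  | exact: Ck_xcoord | exact: Ck_ycoord | apply: CkB | apply: CkD | apply: CkM ].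

Lemma Ck_wx k : Ck k good wx. Proof. by rewrite /wx; Ck_tac. Qed.
Lemma Ck_wy k : Ck k good wy. Proof. by rewrite /wy; Ck_tac. Qed.
Lemma Ck_w'x k : Ck k good w'x. Proof. by rewrite /w'x; Ck_tac. Qed.
Lemma Ck_w'y k : Ck k good w'y. Proof. by rewrite /w'y; Ck_tac. Qed.
Lemma Ck_H0 k : Ck k good H0.
Proof. by rewrite /H0; Ck_tac. Qed.

Lemma Ck_gQ k (U : set V) : open U -> Ck k U (fun z => g (Q z)).
Proof. by move=> oU; apply: (Ck_comp (O := setT) oU) => //; exact: Ck_Q. Qed.

Lemma Ck_dgQ k (U : set V) : open U -> Ck k U (fun z => 'D_1 g (Q z)).
Proof.
move=> oU; apply: (Ck_comp (O := setT) (h := 'D_1 g) (f := Q) oU) => //; last exact: Ck_Q.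
by have /CkS[_] := @g_smooth k.+1; exact.
Qed.

Lemma Ck_freq k j : Ck k good (fun z => freq z j).
Proof.
have og := open_good; apply: CkM => //.
  apply: CkM => //; first exact: Ck_cst.
  by apply: CkM => //; [exact: Ck_dgQ|exact: Ck_H0].
case: eqP => _; last exact: Ck_dmoment.
by apply: Ck_sum => // l _; apply: CkM => //; [exact: Ck_cst|exact: Ck_dmoment].
Qed.

Lemma Ck_cos_comp k (f : V -> R) : Ck k good f -> Ck k good (fun z => cos (f z)).
Proof.
by move=> hf; apply: (Ck_comp (O := setT) open_good) => //; exact: (Ck_sincos R k).1.
Qed.

Lemma Ck_sin_comp k (f : V -> R) : Ck k good f -> Ck k good (fun z => sin (f z)).
Proof.
by move=> hf; apply: (Ck_comp (O := setT) open_good) => //; exact: (Ck_sincos R k).2.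
Qed.

Lemma Ck_time k t : Ck k good (fun z => t * g (Q z)).
Proof. by have og := open_good; apply: CkM => //; [exact: Ck_cst|exact: Ck_gQ]. Qed.

Lemma Ck_swap_x1 k t : Ck k good (fun z => swap_x1 (t * g (Q z)) z).
Proof.
have og := open_good; have ht := @Ck_time k t.
by apply: CkD => //; apply: CkM => //; [exact: Ck_cos_comp|exact: Ck_xcoord
  |exact: Ck_sin_comp|exact: Ck_wy].
Qed.

Lemma Ck_swap_y1 k t : Ck k good (fun z => swap_y1 (t * g (Q z)) z).
Proof.
have og := open_good; have ht := @Ck_time k t.
by apply: CkB => //; apply: CkM => //; [exact: Ck_cos_comp|exact: Ck_ycoord
  |exact: Ck_sin_comp|exact: Ck_wx].
Qed.

Lemma Ck_swap_r3 k t : Ck k good (fun z => Num.sqrt (swap_sqnorm3 (t * g (Q z)) z)).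
Proof.
have og := open_good; apply: (Ck_comp (O := [set x | 0 < x]) og).
- by move=> z zg /=; exact: swap_sqnorm3_gt0.
- exact: Ck_sqrt.
apply: CkB => //; first by apply: CkD => //; exact: Ck_sqnorm.
by apply: CkD => //; apply: CkX => //; [exact: Ck_swap_x1|exact: Ck_swap_y1].
Qed.

Lemma Ck_swapx k t j : Ck k good (fun z => xcoord (swap (t * g (Q z)) z) j).
Proof.
have og := open_good; have ht := @Ck_time k t; under eq_fun do rewrite xcoordE.
case: eqP => _; first exact: Ck_swap_x1.
case: eqP => _.
  by apply: CkD => //; apply: CkM => //; [exact: Ck_cos_comp|exact: Ck_xcoord
    |exact: Ck_sin_comp|exact: Ck_w'y].
case: eqP => _; last exact: Ck_xcoord.
by apply: CkM => //; [exact: Ck_ux|exact: Ck_swap_r3].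
Qed.

Lemma Ck_swapy k t j : Ck k good (fun z => ycoord (swap (t * g (Q z)) z) j).
Proof.
have og := open_good; have ht := @Ck_time k t; under eq_fun do rewrite ycoordE.
case: eqP => _; first exact: Ck_swap_y1.
case: eqP => _.
  by apply: CkB => //; apply: CkM => //; [exact: Ck_cos_comp|exact: Ck_ycoord
    |exact: Ck_sin_comp|exact: Ck_w'x].
case: eqP => _; last exact: Ck_ycoord.
by apply: CkM => //; [exact: Ck_uy|exact: Ck_swap_r3].
Qed.

Lemma Ck_flow_good k t : Ck k good (flow t).
Proof.
have og := open_good; have hf j : Ck k good (fun z => t * freq z j).
  by apply: CkM => //; [exact: Ck_cst|exact: Ck_freq].
have hc j := Ck_cos_comp (hf j); have hs j := Ck_sin_comp (hf j).
apply: Ck_rV => // l; case: (split_ordP l) => j ->.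
  under eq_fun do rewrite -/(xcoord _ j) xcoordE.
  apply: CkD => //; apply: CkM => //; [exact: Ck_swapx|exact: Ck_swapy].
under eq_fun do rewrite -/(ycoord _ j) ycoordE.
by apply: CkB => //; apply: CkM => //; [exact: Ck_swapy|exact: Ck_swapx].
Qed.

Lemma smooth_flow t : smooth (flow t).
Proof.
apply/smooth_onE => k; apply: (@Ck_union _ _ _ _ _ good [set z | eps < Q z]).
- by move=> z _; exact: good_or_far.
- exact: Ck_flow_good.
apply: (Ck_ext (f := idfun)); first exact: open_far.
  by move=> z /flow_far ->.
by apply: Ck_linear => z; exact: cvg_id.
Qed.

Lemma Ck_ham k : Ck k setT ham.
Proof.
apply: (@Ck_union _ _ _ _ _ good [set z | eps < Q z]).
- by move=> z _; exact: good_or_far.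
- have og := open_good; apply: CkM => //; [exact: Ck_gQ|exact: Ck_H0].
apply: (Ck_ext (f := fun=> 0)); first exact: open_far.
  by move=> z /g_eps[gz _]; rewrite /ham gz mul0r.
exact: Ck_cst.
Qed.

Lemma smooth_ham : smooth (fun p : R * V => ham p.2).
Proof.
have snd_lin : linear (fun p : R * V => p.2 : V) by [].
pose L : {linear (R * V)%type -> V} :=
  HB.pack (fun p : R * V => p.2 : V) (GRing.isLinear.Build _ _ _ _ _ snd_lin).
apply/smooth_onE => k; apply: (Ck_comp_linear (L := L)); last exact: Ck_ham.
by move=> p; exact: cvg_snd.
Qed.

(** Where Q <= eps all the integrals are bounded, and each dominates its own |z_j|^2; |z_1|^2 is
    dominated by the integral of index i2. *)
Lemma ham_support : exists2 K : set V, compact K & forall z, ~ K z -> ham z = 0.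
Proof.
(* From 2 s <= 1 + s^2, a deviation s with s^2 <= eps satisfies s <= 1 + eps. *)
pose B := 1 + eps + \sum_j `|m0 j|.
have m0B j : m0 j <= \sum_j `|m0 j|.
  rewrite (bigD1 j)//= (le_trans (ler_norm _))// lerDl sumr_ge0// => l _.
have QB z j : Q z <= eps -> j != i1 -> moment z j <= B.
  move=> zeps j1.
  have h : dmoment z j ^+ 2 <= eps.
    apply: le_trans zeps; rewrite /Q (bigD1 j)//= lerDl.
    by apply: sumr_ge0 => l _; exact: sqr_ge0.
  have -> : moment z j = dmoment z j + m0 j by rewrite subrK.
  have := m0B j; have := sqr_ge0 (dmoment z j); have := sqr_ge0 (dmoment z j - 1).
  rewrite /B; move: (dmoment z j) (\sum_j _) h => x S; rewrite !expr2; lra.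
have NB z j : Q z <= eps -> sqnorm z j <= B.
  move=> zeps; have [->|j1] := eqVneq j i1.
    apply: le_trans (QB z i2 zeps _); last by rewrite eq_sym.
    by rewrite /moment /weight eqxx mul1r lerDr sqnorm_ge0.
  apply: le_trans (QB z j zeps j1); rewrite lerDl mulr_ge0// ?sqnorm_ge0//.
(* A coordinate with x^2 <= B satisfies |x| <= 1 + B, so a cube of this half-width contains the
   sublevel set. *)
exists [set z : V | forall k, `[(- (1 + B)), (1 + B)]%classic (z 0 k)].
  apply: (@rV_compact _ _ (fun=> `[(- (1 + B)), (1 + B)]%classic)) => k.
  exact: segment_compact.
move=> z Kz; rewrite /ham; have [zeps|/g_eps[-> _]] := leP (Q z) eps; last by rewrite mul0r.
exfalso; apply: Kz => k; rewrite /= in_itv /=.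
case: (split_ordP k) => j ->; have := NB z j zeps; rewrite /sqnorm /xcoord /ycoord.
  by have := sqr_ge0 (z 0 (rshift n j)); nra.
by have := sqr_ge0 (z 0 (lshift n j)); nra.
Qed.

Lemma Ham_c_flow : Ham_c (flow 1).
Proof.
split.
  split; first exact: smooth_flow.
  exists (flow (-1)); split; first exact: smooth_flow.
    by move=> z; rewrite flowD addNr flow0.
  by move=> z; rewrite flowD subrr flow0.
have [K Kc HK] := ham_support.
exists (fun p : R * V => ham p.2), flow; split => //.
  by split; [exact: smooth_ham|exists K => // t z _; exact: HK].
exists (fun=> flow_vf); split=> [t _ z v|z|t z _].
- exact: ham_vf.
- exact: flow0.
- exact: flow_cvg.
Qed.

(** Here Q = 0, and the vanishing cosine leaves only the off-diagonal part of the rotation: z_1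
    becomes w up to a unit factor, and |w| = |z_2|. The other values follow from the conservation
    laws, and the rotations do not affect moduli. *)
Lemma sqnorm_flow t z : 0 <= eps -> (forall j, j != i1 -> dmoment z j = 0) ->
  cos (t * g 0) = 0 ->
  [/\ sqnorm (flow t z) i1 = sqnorm z i2, sqnorm (flow t z) i2 = sqnorm z i1,
      sqnorm (flow t z) i3 = sqnorm z i3 + sqnorm z i1 - sqnorm z i2
    & forall j, j != i1 -> j != i2 -> j != i3 -> sqnorm (flow t z) j = sqnorm z j].
Proof.
move=> eps0 dm0 c0.
have Q0 : Q z = 0 by rewrite /Q big1// => j j1; rewrite dm0// expr0n.
have zg : good z by apply: good_eps; rewrite Q0.
have s1 : sin (t * g 0) ^+ 2 = 1 by rewrite -(cos2Dsin2 (t * g 0)) c0 expr0n add0r.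
have u1 := u_unit zg.
have N1 : sqnorm (swap (t * g 0) z) i1 = sqnorm z i2.
  rewrite swap_sqnorm1 /swap_x1 /swap_y1 c0 !mul0r add0r sub0r sqrrN !exprMn s1.
  rewrite /wx /wy !mul1r -[RHS]mulr1 -u1 /sqnorm; ring.
have N12 := swap_sqnorm12 (t * g 0) zg.
rewrite /flow !sqnorm_rotate Q0; split=> [||| j j1 j2 j3].
- exact: N1.
- by move: N12; rewrite N1 => N12; lra.
- by rewrite sqnorm3_swap// /swap_sqnorm3 -swap_sqnorm1 N1.
- by rewrite sqnorm_rotate sqnorm_swap_other.
Qed.

End TimeFlow.

End Flow.

(** * The volume of a product torus *)

Section Angle.
Variable R : realType.
Local Notation pi := (@pi R).

Lemma polar_angle (r x y : R) : 0 < r -> x ^+ 2 + y ^+ 2 = r ^+ 2 ->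
  exists2 t, - pi < t <= pi & x = r * cos t /\ y = r * sin t.
Proof.
move=> r0 xyr; have rn0 : r != 0 by rewrite gt_eqF.
pose c := x / r; pose s := y / r.
have cs : c ^+ 2 + s ^+ 2 = 1.
  by rewrite !expr_div_n -mulrDl xyr divff// sqrf_eq0.
have c1 : -1 <= c <= 1.
  by rewrite -ler_norml -sqrtr_sqr -[leRHS]sqrtr1 ler_sqrt// -cs lerDl sqr_ge0.
have [/andP[t0 tpi] ct] := acos_def c1; move: (acos c) t0 tpi ct => t t0 tpi ct.
have st0 : 0 <= sin t by rewrite sin_ge0_pi// t0 tpi.
have st : sin t ^+ 2 = s ^+ 2.
  by apply: (@addrI _ (c ^+ 2)); rewrite cs -[in LHS]ct cos2Dsin2.
have xE : x = r * c by rewrite mulrC divfK.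
have yE : y = r * s by rewrite mulrC divfK.
have [s0|s0] := leP 0 s.
  exists t; first by rewrite tpi andbT (lt_le_trans _ t0)// oppr_lt0 pi_gt0.
  rewrite ct; split=> //; rewrite yE; congr (_ * _); apply/esym/eqP.
  by rewrite -(@eqrXn2 _ 2)// st.
have sE : s = - sin t.
  apply/eqP; rewrite -[s]opprK eqr_opp -(@eqrXn2 _ 2)// ?sqrrN ?st//.
  by rewrite oppr_ge0 ltW.
exists (- t); last by rewrite cosN sinN ct -sE.
(* The interval is open at [- pi]: t = [pi] would make s zero, against s < 0. *)
rewrite ltrN2 lt_neqAle tpi andbT; apply/andP; split.
  by apply/eqP => tE; move: s0; rewrite sE tE sinpi oppr0 ltxx.
by rewrite (le_trans _ (pi_ge0 R))// oppr_le0.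
Qed.

(** Injectivity of the cosine on [0, pi] gives t = t' or t = - t'. In the latter case the sines
    force sin t' = 0, and the half-open interval leaves only t' = 0. *)
Lemma polar_angle_inj (t t' : R) : - pi < t <= pi -> - pi < t' <= pi ->
  cos t = cos t' -> sin t = sin t' -> t = t'.
Proof.
move=> /andP[t1 t2] /andP[t1' t2'] ct st.
have cn (u : R) : cos `|u| = cos u by case: (ger0P u) => // _; rewrite cosN.
have nt (u : R) : - pi < u -> u <= pi -> `|u| \in `[0, pi].
  by move=> h1 h2; rewrite in_itv /= normr_ge0 ler_norml (ltW h1) h2.
have : `|t| = `|t'|.
  by apply: cos_inj; rewrite ?nt// !cn.
move=> /eqP; rewrite eqr_norm2 => /orP[/eqP //|/eqP tE].
have s0 : sin t' = 0 by move: st; rewrite tE sinN => st; lra.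
have sn0 (u : R) : 0 < u -> u < pi -> sin u <> 0.
  by move=> h1 h2; apply/eqP; rewrite gt_eqF// sin_gt0_pi// h1 h2.
have [t'0|t'0|t'0] := ltgtP 0 t'.
- have tpi : t' < pi by move: t1; rewrite tE ltrN2.
  by case: (sn0 t').
- case: (sn0 (- t')); rewrite ?oppr_gt0//; first by rewrite ltrNl.
  by rewrite sinN s0 oppr0.
- by rewrite tE -t'0 oppr0.
Qed.

End Angle.

(** * Measure of the cube of angles *)

Section Volume.
Variable R : realType.
Local Notation pi := (@pi R).

(** Half-open, so that a single piece parametrises the whole torus bijectively. *)
Definition angle_box n : set 'rV[R]_n := [set x | forall j, - pi < x 0 j <= pi].

Lemma borel_angle_box n : borel_rV (@angle_box n).
Proof.
have mgt j (c : R) : borel_rV [set x : 'rV[R]_n | c < x 0 j].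
  apply: sub_sigma_algebra.
  apply: (open_comp (f := fun x : 'rV[R]_n => x 0 j) (D := [set y | c < y])).
    by move=> x _; exact: coord_continuous.
  exact: open_gt.
pose T := g_sigma_algebraType (@open 'rV[R]_n).
suff : @measurable _ T (@angle_box n) by [].
rewrite (_ : @angle_box n = \bigcap_(j in [set: 'I_n])
  ([set x | - pi < x 0 j] `&` ~` [set x | pi < x 0 j])); last first.
  apply/seteqP; split=> [x xb j _|x xb j].
    by have /andP[h1 h2] := xb j; split=> //=; apply/negP; rewrite -leNgt.
  by have [/= h1 /negP h2] := xb j I; rewrite h1 /= leNgt.
apply: (@fin_bigcap_measurable _ T) => // j _.
apply: measurableI; first exact: mgt.
by apply: measurableC; exact: mgt.
Qed.

Lemma integral_angle_box n (c : R) : 0 <= c ->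
  integral_rV (fun x : 'rV[R]_n => (\1_(@angle_box n) x * c)%:E)
  = ((2 * pi) ^+ n * c)%:E.
Proof.
elim: n c => [|n IH] c c0.
  by rewrite /= indicE mem_set ?expr0// => -[].
rewrite /=.
pose I : set R := `]- pi, pi]%classic.
have mI : measurable I by exact: measurable_itv.
rewrite [X in integral _ _ X](_ : _ =
  fun t => (((2 * pi) ^+ n * c)%:E * (\1_I t)%:E)%E); last first.
  apply/funext => t.
  (* The indicator of the cube factors through the first coordinate, and the factor [\1_I t] is
     absorbed into the constant; hence the induction over arbitrary [c]. *)
  rewrite (_ : (fun v => _) = (fun v : 'rV[R]_n => (\1_(@angle_box n) v * (\1_I t * c))%:E)).
    rewrite IH ?mulr_ge0//.
    by rewrite -EFinM; congr (_%:E); ring.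
  apply/funext => v; congr (_%:E); rewrite mulrA; congr (_ * c).
  rewrite !indicE.
  have -> : (row_mx t%:M v \in @angle_box n.+1) = (v \in @angle_box n) && (t \in I).
    apply/idP/andP => [/set_mem H|[/set_mem H1 /set_mem H2]].
      split; apply/mem_set.
        by move=> j; have := H (rshift 1 j); rewrite (@row_mxEr _ 1 1 n).
      have := H (@lshift 1 n 0); rewrite (@row_mxEl _ 1 1 n) mxE eqxx mulr1n.
      by rewrite /I /= in_itv.
    apply/mem_set => j; case: (@split_ordP 1 n j) => k ->.
      rewrite (@row_mxEl _ 1 1 n) mxE ord1 eqxx mulr1n.
      by move: H2; rewrite /I /= in_itv.
    by rewrite (@row_mxEr _ 1 1 n); exact: H1.
  by case: (_ \in _); case: (_ \in _); rewrite ?mulr0 ?mul0r ?mulr1.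
rewrite ge0_integralZl//=; first last.
- by rewrite lee_fin mulr_ge0// exprn_ge0// mulr_ge0// pi_ge0.
- by apply/measurable_EFinP; exact: measurable_indic.
have muI : lebesgue_measure I = (2 * pi)%:E.
  have pi0 := pi_gt0 R; rewrite /I lebesgue_measure_itv/= lte_fin ifT; last by lra.
  by rewrite -EFinB; congr (_%:E); ring.
rewrite integral_indic// setIT.
transitivity (((2 * pi) ^+ n * c)%:E * (2 * pi)%:E)%E; first by congr (_ * _)%E.
by rewrite -EFinM; congr (_%:E); rewrite exprS; ring.
Qed.

End Volume.

(** * Volume in angular coordinates *)

Section TorusVolume.
Variables (R : realType) (n : nat) (r : 'I_n -> R).
Hypothesis r0 : forall j, 0 < r j.
Local Notation pi := (@pi R).

Definition torus_chart (x : 'rV[R]_n) : 'rV[R]_(n + n) :=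
  of_coords (fun j => r j * cos (x 0 j)) (fun j => r j * sin (x 0 j)).

Lemma smooth_torus_chart : smooth_on setT torus_chart.
Proof.
have oT := @openT 'rV[R]_n; apply/smooth_onE => k; apply: Ck_rV => // l.
case: (split_ordP l) => j ->.
  under eq_fun do rewrite -/(xcoord _ j) xcoordE.
  apply: CkM => //; first exact: Ck_cst.
  by apply: (Ck_comp (O := setT)) => //; [exact: (Ck_sincos R k).1|exact: Ck_coord].
under eq_fun do rewrite -/(ycoord _ j) ycoordE.
apply: CkM => //; first exact: Ck_cst.
by apply: (Ck_comp (O := setT)) => //; [exact: (Ck_sincos R k).2|exact: Ck_coord].
Qed.

Lemma is_derive_torus_chart (x v : 'rV[R]_n) : is_derive x v torus_chart
  (of_coords (fun j => - (r j * sin (x 0 j) * v 0 j)) (fun j => r j * cos (x 0 j) * v 0 j)).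
Proof.
apply: is_derive_rV => k; case: (split_ordP k) => j ->.
  rewrite -!/(xcoord _ j) xcoordE; under eq_fun do rewrite -!/(xcoord _ j) xcoordE.
  refine (is_derive_eq (is_derive_mul (is_derive_cst (r j) _ _) (is_derive_compR
    (f := fun y : 'rV[R]_n => y 0 j) (is_derive_cos _) (is_derive_coord j x v))) _).
  by rewrite /cst /=; ring.
rewrite -!/(ycoord _ j) ycoordE; under eq_fun do rewrite -!/(ycoord _ j) ycoordE.
refine (is_derive_eq (is_derive_mul (is_derive_cst (r j) _ _) (is_derive_compR
  (f := fun y : 'rV[R]_n => y 0 j) (is_derive_sin _) (is_derive_coord j x v))) _).
by rewrite /cst /=; ring.
Qed.

Lemma jacobian_torus_chart (x : 'rV[R]_n) i : row i (jacobian torus_chart x) =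
  of_coords (fun j => - (r j * sin (x 0 j) * (i == j)%:R))
    (fun j => r j * cos (x 0 j) * (i == j)%:R).
Proof.
have dp : differentiable torus_chart x by exact: (smooth_torus_chart [::]).
rewrite rowE -deriveEjacobian//.
have [_ ->] := is_derive_torus_chart x (delta_mx 0 i).
by congr of_coords; apply/funext => j; rewrite mxE eqxx /= (eq_sym j).
Qed.

(** The partial derivatives are tangent to distinct circle factors, hence orthogonal, with lengths
    the radii. Both the volume density and the rank of the Jacobian are read off from this. *)
Lemma gram_torus_chart (x : 'rV[R]_n) :
  jacobian torus_chart x *m (jacobian torus_chart x)^T
  = diag_mx (\row_j r j ^+ 2).
Proof.
apply/matrixP => i k; rewrite [LHS]mxE [RHS]mxE [X in X *+ _]mxE.
under eq_bigr => l _ do rewrite [X in _ * X]mxE.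
rewrite big_split_ord /= -big_split /=.
have JE a l : jacobian torus_chart x a l = row a (jacobian torus_chart x) 0 l.
  by rewrite [RHS]mxE.
under eq_bigr => l _ do rewrite !JE !jacobian_torus_chart -!/(xcoord _ l)
  -!/(ycoord _ l) !xcoordE !ycoordE.
rewrite (bigD1 i)//= big1 ?addr0 => [|l li]; last first.
  by rewrite eq_sym (negbTE li) !mulr0 oppr0 !mul0r addr0.
rewrite eqxx; have [->|ki] := eqVneq i k.
  rewrite ?eqxx !mulr1 mulr1n -[RHS]mulr1 -(cos2Dsin2 (x 0 k)); ring.
by rewrite ?(eq_sym k) ?(negbTE ki) !mulr0 oppr0 mulr0 addr0.
Qed.

Lemma volume_density_torus_chart (x : 'rV[R]_n) :
  volume_density torus_chart x = \prod_j r j.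
Proof.
rewrite /volume_density gram_torus_chart det_diag.
under eq_bigr => j _ do rewrite mxE.
rewrite prodrXl sqrtr_sqr ger0_norm//; apply: prodr_ge0 => j _; exact: ltW.
Qed.

Lemma row_free_jacobian_torus_chart (x : 'rV[R]_n) :
  row_free (jacobian torus_chart x).
Proof.
apply/row_freeP; exists ((jacobian torus_chart x)^T *m diag_mx (\row_j (r j ^+ 2)^-1)).
rewrite mulmxA gram_torus_chart mulmx_diag -diag_const_mx; congr diag_mx.
apply/rowP => j; rewrite !mxE divff//.
by rewrite sqrf_eq0 gt_eqF.
Qed.

Lemma riemannian_volume_torus (L : set 'rV[R]_(n + n)) :
  L = [set z | forall j, sqnorm z j = r j ^+ 2] ->
  riemannian_volume n L ((2 * pi) ^+ n * \prod_j r j)%:E.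
Proof.
move=> LE; have pL x : L (torus_chart x).
  rewrite LE => j; rewrite /sqnorm xcoordE ycoordE -[RHS]mulr1 -(cos2Dsin2 (x 0 j)).
  ring.
exists 1%N, (fun=> setT), (fun=> @angle_box R n), (fun=> torus_chart).
split.
- move=> _; split; first exact: openT.
    split; first exact: smooth_torus_chart.
    by move=> x _; exact: row_free_jacobian_torus_chart.
  by move=> _ [x _ <-]; exact: pL.
- move=> _; split; [exact: borel_angle_box|by []|move=> x y Ax Ay xy].
  apply/rowP => j; apply: polar_angle_inj => //.
    have := congr1 (fun z => xcoord z j) xy; rewrite !xcoordE; apply: mulfI.
    by rewrite gt_eqF.
  have := congr1 (fun z => ycoord z j) xy; rewrite !ycoordE; apply: mulfI.
  by rewrite gt_eqF.
- apply/seteqP; split=> [z|z [_ _ [x _ <-]]]; last exact: pL.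
  rewrite LE => Lz; exists ord0 => //.
  have ang j : exists t, - pi < t <= pi /\
      (xcoord z j = r j * cos t /\ ycoord z j = r j * sin t).
    by have [t] := polar_angle (r0 j) (Lz j); exists t.
  have [t tP] := choice ang.
  exists (\row_j t j); first by move=> j; rewrite mxE; exact: (tP j).1.
  by apply: coordsP => j; have [_ [tx ty]] := tP j; rewrite ?xcoordE ?ycoordE mxE.
- by move=> i j _ _ _; rewrite !ord1.
rewrite big_ord1 /= -integral_angle_box; last first.
  by apply: prodr_ge0 => j _; exact: ltW.
by congr integral_rV; apply/funext => x; rewrite volume_density_torus_chart.
Qed.

End TorusVolume.

(** * The swap of two circles *)

Section CutOff.
Variable R : realType.
Variable eps : R.
Hypothesis eps0 : 0 < eps.

(** Normalised to [pi / 2] at s = 0, so that the time-one flow makes a quarter turn on the torus;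
    [flat 0 (eps - s)] vanishes from s = eps on. *)
Definition cutoff (s : R) : R := pi / 2 / flat 0 eps * flat 0 (eps - s).

Lemma cutoff0 : cutoff 0 = pi / 2.
Proof.
rewrite /cutoff subr0 divfK// /flat eps0 expr0 mul1r gt_eqF//.
exact: expR_gt0.
Qed.

Lemma cutoff_eps s : eps < s -> cutoff s = 0 /\ 'D_1 cutoff s = 0.
Proof.
have c0 t : eps < t -> cutoff t = 0.
  by move=> et; rewrite /cutoff [flat 0 (eps - t)]/flat subr_gt0 ltNge (ltW et) mulr0.
move=> es; split; first exact: c0.
rewrite -(derive_cst (0 : R) s (1 : R)); apply: near_eq_derive.
near=> t; rewrite c0//; near: t; exact: lt_nbhsr.
Unshelve. all: by end_near. Qed.

Lemma Ck_cutoff k : Ck k setT cutoff.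
Proof.
have oT := @openT R; apply: CkM => //; first exact: Ck_cst.
apply: (Ck_comp (O := setT)) => //; first exact: Ck_flat.
apply: CkB => //; first exact: Ck_cst.
by apply: (Ck_linear (f := idfun)) => z; exact: cvg_id.
Qed.

End CutOff.

Lemma product_torusE (R : realType) (n : nat) (b : 'I_n -> R) :
  (forall j, 0 <= b j) -> product_torus b = [set z | forall j, sqnorm z j = b j / pi].
Proof.
move=> b0; have bp j : 0 <= b j / pi by rewrite divr_ge0 ?pi_ge0.
apply/seteqP; split=> z zb j; rewrite /circle /=; last first.
  by rewrite -/(sqnorm z j) zb.
have /(congr1 (fun x => x ^+ 2)) := zb j.
by rewrite !sqr_sqrtr//; exact: sqnorm_ge0.
Qed.

(** Sorting the duplicate-free list of values makes its first three entries strictly increasing. *)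
Lemma num_distinct_ge3 (R : realType) (n : nat) (b : 'I_n -> R) :
  (3 <= num_distinct b)%N -> exists i1 i2 i3, b i1 < b i2 /\ b i2 < b i3.
Proof.
rewrite /num_distinct -(size_sort <=%O).
have := sort_lt_sorted (undup (codom b)); rewrite undup_uniq.
have : {subset sort <=%O (undup (codom b)) <= codom b}.
  by move=> x; rewrite mem_sort mem_undup.
case: (sort _ _) => [|x [|y [|z s]]]// sub /= /and3P[xy yz _] _.
have /codomP[i1 x1] := sub x (mem_head _ _).
have /codomP[i2 y2] : y \in codom b by apply: sub; rewrite !inE eqxx orbT.
have /codomP[i3 z3] : z \in codom b by apply: sub; rewrite !inE eqxx !orbT.
by exists i1, i2, i3; rewrite -x1 -y2 -z3.
Qed.

(** * The torus over the reflected point *)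

Section SwapTorus.
Variables (R : realType) (n : nat) (i1 i2 i3 : 'I_n) (B : 'I_n -> R).
Hypotheses (i12 : i1 != i2) (i13 : i1 != i3) (i23 : i2 != i3).
Hypotheses (B23 : B i2 < B i3).

Definition swapped (j : 'I_n) := if j == i1 then B i2 else if j == i2 then B i1
  else if j == i3 then B i3 + B i1 - B i2 else B j.

(** With [B] the squared radii, these are the values of the integrals on the original torus. They
    are the same for [swapped]: the sums of indices i1, i2 and of i1, i3 are unchanged. *)
Let m0 (j : 'I_n) := B j + weight R i2 i3 j * B i1.
Let eps := (B i3 - B i2) ^+ 2 / 4.
Let phi := flow i1 i2 i3 m0 (cutoff eps).

Let eps_gt0 : 0 < eps.
Proof. by rewrite divr_gt0// exprn_gt0// subr_gt0. Qed.

(** Let p and q be the deviations of the integrals of index i2 and i3. If |z_3| <= |z_2| then p - q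
    >= B i3 - B i2, so p^2 + q^2 >= (p - q)^2 / 2 is at least (B i3 - B i2)^2 / 2, which is twice
    [eps]. *)
Lemma good_cutoff (z : 'rV[R]_(n + n)) : Q i1 i2 i3 m0 z <= eps -> good i2 i3 z.
Proof.
have i21 : i2 != i1 by rewrite eq_sym.
rewrite /Q (bigD1 i2)//= (bigD1 i3)/=; last by rewrite !(eq_sym i3) i13.
set S := \sum_(_ | _) _; have S0 : 0 <= S by apply: sumr_ge0 => j _; exact: sqr_ge0.
rewrite /dmoment /moment /m0 /weight !eqxx orbT !mul1r /good /eps.
move: S S0 B23; move: (sqnorm z i1) (sqnorm z i2) (sqnorm z i3) (B i1) (B i2) (B i3).
move=> x1 x2 x3 b1 b2 b3 S S0 b23 h; rewrite ltNge; apply/negP => x32.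
have d : 0 < (b3 - b2) * (b3 - b2) by rewrite mulr_gt0// subr_gt0.
pose p := x2 + x1 - (b2 + b1); pose q := x3 + x1 - (b3 + b1).
have pq : b3 - b2 <= p - q by rewrite /p /q; lra.
have : (b3 - b2) ^+ 2 <= (p - q) ^+ 2 by rewrite ler_pXn2r// nnegrE; lra.
have := sqr_ge0 (p + q); move: h; rewrite -/p -/q !expr2.
lra.
Qed.

Lemma Ham_c_swap_torus : Ham_c (phi 1).
Proof.
apply: (Ham_c_flow i12 i13 i23 (eps := eps)).
- exact: cutoff_eps.
- exact: good_cutoff.
- by move=> k; exact: Ck_cutoff.
Qed.

(* On these tori Q vanishes to second order, so that the flow is swap (pi / 2). *)
Lemma swap_torus_image :
  phi 1 @` [set z | forall j, sqnorm z j = B j]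
  = [set z | forall j, sqnorm z j = swapped j].
Proof.
have i21 : (i2 == i1) = false by rewrite eq_sym (negbTE i12).
have i31 : (i3 == i1) = false by rewrite eq_sym (negbTE i13).
have i32 : (i3 == i2) = false by rewrite eq_sym (negbTE i23).
have F t z := @sqnorm_flow _ _ _ _ _ i12 i13 i23 _ (cutoff eps) _ good_cutoff t z (ltW eps_gt0).
have c1 : cos (1 * cutoff eps 0) = 0 by rewrite mul1r cutoff0// cos_pihalf.
have cN1 : cos (-1 * cutoff eps 0) = 0 by rewrite mulN1r cosN cutoff0// cos_pihalf.
apply/seteqP; split=> [_ [z zB <-]|z zB].
  have dm0 j : j != i1 -> dmoment i1 i2 i3 m0 z j = 0.
    by move=> _; rewrite /dmoment /moment !zB subrr.
  have [f1 f2 f3 fo] := F 1 z dm0 c1.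
  rewrite !zB in f1 f2 f3 => j; rewrite /swapped.
  have [->//|j1] := eqVneq j i1; have [->//|j2] := eqVneq j i2.
  by have [->//|j3] := eqVneq j i3; rewrite fo// zB.
have dm0 j : j != i1 -> dmoment i1 i2 i3 m0 z j = 0.
  move=> j1; rewrite /dmoment /moment /m0 /weight !zB /swapped eqxx (negbTE j1).
  have [->|j2] := eqVneq j i2; first by rewrite /= !mul1r; ring.
  have [->|j3] := eqVneq j i3; first by rewrite /= !mul1r; ring.
  by rewrite !mul0r subrr.
(* Q vanishes on the swapped torus too, so the backward flow makes a quarter turn there and
   exchanges the radii back. *)
exists (phi (-1) z); last first.
  rewrite /phi (flowD i12 i13 i23 (@cutoff_eps R eps) good_cutoff) subrr.
  exact: flow0.
have [f1 f2 f3 fo] := F (-1) z dm0 cN1.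
rewrite !zB /swapped !(i21, i31, i32, eqxx) in f1 f2 f3 => j.
have [->//|j1] := eqVneq j i1; have [->//|j2] := eqVneq j i2.
have [->|j3] := eqVneq j i3; first by rewrite f3; ring.
by rewrite fo// zB /swapped (negbTE j1) (negbTE j2) (negbTE j3).
Qed.

End SwapTorus.

(** * Comparison of the two volumes *)

Theorem corollary3 (R : realType) (n : nat) (b : 'I_n -> R) :
  (1 <= n)%N ->
  (forall i : 'I_n, 0 < b i) ->
  (3 <= num_distinct b)%N ->
  ~ hamiltonian_volume_minimizing (product_torus b).
Proof.
move=> _ b0 /num_distinct_ge3[i1 [i2 [i3 [b12 b23]]]].
have pi0 := pi_gt0 R.
have neq (i j : 'I_n) : b i < b j -> i != j.
  by apply: contraTneq => ->; rewrite ltxx.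
have i12 := neq _ _ b12; have i23 := neq _ _ b23.
have i13 := neq _ _ (lt_trans b12 b23).
pose B j := b j / pi; have B0 j : 0 < B j by rewrite divr_gt0.
have B12 : B i1 < B i2 by rewrite ltr_pM2r ?invr_gt0.
have B23 : B i2 < B i3 by rewrite ltr_pM2r ?invr_gt0.
pose B' := swapped i1 i2 i3 B.
have B'0 j : 0 < B' j.
  rewrite /B' /swapped; case: eqP => // _; case: eqP => // _; case: eqP => // _.
  have := B0 i1; lra.
have sq (C : 'I_n -> R) j : (forall j, 0 < C j) -> C j = Num.sqrt (C j) ^+ 2.
  by move=> C0; rewrite sqr_sqrtr// ltW.
have vol (C : 'I_n -> R) : (forall j, 0 < C j) ->
    riemannian_volume n [set z : 'rV[R]_(n + n) | forall j, sqnorm z j = C j]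
      ((2 * pi) ^+ n * \prod_j Num.sqrt (C j))%:E.
  move=> C0; apply: riemannian_volume_torus; first by move=> j; rewrite sqrtr_gt0.
  by apply/seteqP; split=> z zC j; rewrite zC // -sq.
rewrite product_torusE => [|j]; last exact: ltW.
move=> /(_ _ (Ham_c_swap_torus i12 i13 i23 B23) _ _ (vol B B0)).
rewrite swap_torus_image// => /(_ _ (vol B' B'0)).
rewrite lee_fin ler_pM2l; last by rewrite exprn_gt0// mulr_gt0.
apply/negP; rewrite -ltNge.
have split3 (F : 'I_n -> R) : \prod_j F j =
    F i1 * (F i2 * (F i3 * \prod_(j | (j != i1) && (j != i2) && (j != i3)) F j)).
  rewrite (bigD1 i1)//= (bigD1 i2)/=; last by rewrite eq_sym.
  by rewrite (bigD1 i3)//= !(eq_sym i3) i13.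
rewrite !split3.
rewrite [X in _ * (_ * (_ * X)) < _](eq_bigr (fun j => Num.sqrt (B j))); last first.
  by move=> j /andP[/andP[/negbTE j1 /negbTE j2] /negbTE j3]; rewrite /B' /swapped j1 j2 j3.
rewrite /B' /swapped !eqxx !(eq_sym i2) !(eq_sym i3) (negbTE i12) (negbTE i13) (negbTE i23).
(* The exchanged factors of i1 and i2 cancel, and so do those of the other indices; what remains is
   B i3 + B i1 - B i2 < B i3 under the square root. *)
rewrite mulrCA !ltr_pM2l ?sqrtr_gt0// ltr_pM2r.
  by rewrite ltr_sqrt//; lra.
by apply: prodr_gt0 => j _; rewrite sqrtr_gt0.
Qed.
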